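(* Let $X$ be a locally compact metric space and $f\colon X\to X$ a continuous map. For every isolated invariant set $S$ of $f$, the reduced mapping torus index $\operatorname{CT}_\bullet(S,f)$ is the flow Conley index of $(I_fS,\varphi_f)$, where $\varphi_f$ is the suspension semiflow of $f$ on $\operatorname{T}(f)$ and $I_fS\subset\operatorname{T}(f)$ is the suspension of $S$.
   Context: For $M\subset X$, $\operatorname{Inv}(M,f)$ is the set of $x\in M$ for which there is a sequence $\gamma\colon\mathbb{Z}\to M$ with $\gamma(0)=x$ and $\gamma(n+1)=f(\gamma(n))$ for all $n\in\mathbb{Z}$. A set $S\subset X$ is isolated invariant if it is compact and has a neighborhood $M$ with $\operatorname{Inv}(M,f)=S$. Quotients: for $\varnothing\ne Y\subset Z$, $Z/Y$ is the pointed quotient space with base point $[Y]$; $Z/\varnothing:=Z\sqcup\{*\}$ with base point $*$ (denoted $[\varnothing]$). For a pointed space $(P,p_0)$ and a space $Y$, $(P,p_0)\rtimes Y:=(P\times Y)/(\{p_0\}\times Y)$. Index pairs for maps: a pair $(N,L)$ of compact sets $L\subset N\subset X$ is an index pair for $(S,f)$ if $\operatorname{Inv}(\operatorname{cl}(N\setminus L),f)=S\subset\operatorname{int}(N\setminus L)$ and the map $f_{(N,L)}\colon N/L\to N/L$ given by $f_{(N,L)}([x])=[f(x)]$ if $x,f(x)\in N\setminus L$ and $f_{(N,L)}([x])=[L]$ otherwise is continuous. Mapping tori: $\operatorname{T}(f):=(X\times[0,1])/\big((x,1)\sim(f(x),0)\big)$. For a pointed continuous map $\kappa\colon(P,p_0)\to(P,p_0)$,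 the reduced mapping torus is $\operatorname{T}_\bullet(\kappa):=\big((P,p_0)\rtimes[0,1]\big)/\big((x,1)\sim(\kappa(x),0)\big)$, a pointed space. The reduced mapping torus index $\operatorname{CT}_\bullet(S,f)$ is the pointed homotopy type of $\operatorname{T}_\bullet(f_{(N,L)})$ for an index pair $(N,L)$ for $(S,f)$ (independent of the choice). Suspension: the suspension semiflow is $\varphi_f\colon\operatorname{T}(f)\times[0,\infty)\to\operatorname{T}(f)$, $\varphi_f([x,\theta],t)=[f^{\lfloor\theta+t\rfloor}(x),\theta+t-\lfloor\theta+t\rfloor]$. For $A\subset X$, $I_fA:=\{[x,\theta]\in\operatorname{T}(f)\mid x\in A,\ \theta\in[0,1]\}$. Flow Conley index: for a semiflow $\varphi$ on a space $W$ and $M\subset W$, $\operatorname{Inv}(M,\varphi)$ is the set of $x\in M$ for which there is a full solution $\gamma\colon\mathbb{R}\to M$ of $\varphi$ with $\gamma(0)=x$. A pair of compact sets $\tilde L\subset\tilde N\subset W$ is an index pair for $(\tilde S,\varphi)$ if (i) $\tilde S=\operatorname{Inv}(\operatorname{cl}(\tilde N\setminus\tilde L),\varphi)\subset\operatorname{int}(\tilde N\setminus\tilde L)$; (ii) if $x\in\tilde L$, $t>0$ and $\varphi(x,[0,t])\subset\tilde N$, then $\varphi(x,[0,t])\subset\tilde L$; (iii) if $x\in\tilde N$, $t>0$ and $\varphi(x,t)\notin\tilde N$, then there is $t'\in[0,t]$ with $\varphi(x,t')\in\tilde L$ and $\varphi(x,[0,t'])\subset\tilde N$. The flow Conley index of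 $(\tilde S,\varphi)$ is the pointed homotopy type of $\tilde N/\tilde L$ for an index pair $(\tilde N,\tilde L)$ for $(\tilde S,\varphi)$.
   Formalization: An index pair for the suspension semiflow need not exist (X the real line, f = 0, S = {0}), so its existence is claimed only when I_fS has a compact neighborhood in T(f), a necessary condition; the two indices are identified for all index pairs without it. *)

(* Defs.v *)
From HB Require Import structures.
From mathcomp Require Import all_boot all_order all_algebra.
From mathcomp Require Import all_classical all_reals all_analysis.
From Stdlib Require Relation_Operators.

Set Implicit Arguments.
Unset Strict Implicit.
Unset Printing Implicit Defensive.

Import Order.TTheory GRing.Theory Num.Theory.
Import numFieldTopology.Exports.

Local Open Scope classical_set_scope.
Local Open Scope ring_scope.

Definition I01 (R : realType) : set R := `[0, 1]%classic.
Arguments I01 R : clear implicits.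

Lemma I_proof (R : realType) (r : R) :
  0 <= r <= 1 -> r \in I01 R.
Proof. by move=> h; apply/mem_set; rewrite /I01 /= in_itv. Qed.

Lemma frac_bounds (R : realType) (r : R) :
  0 <= r - (Num.floor r)%:~R <= 1.
Proof.
rewrite subr_ge0 floor_le lerBlDl.
by have /ltW := floorD1_gt r; rewrite intrD addrC.
Qed.

Lemma zero_bounds (R : realType) : 0 <= (0 : R) <= 1.
Proof. by rewrite lexx ler01. Qed.

Lemma one_bounds (R : realType) : 0 <= (1 : R) <= 1.
Proof. by rewrite lexx ler01. Qed.

Definition mkI (R : realType) (r : R) (h : 0 <= r <= 1) : I01 R :=
  exist _ r (I_proof h).
Definition zeroI (R : realType) : I01 R := mkI (zero_bounds R).
Definition oneI (R : realType) : I01 R := mkI (one_bounds R).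
Definition fracI (R : realType) (r : R) : I01 R := mkI (frac_bounds r).

(* The points are those of [Z] outside [Y], and the base point [None].  A set
   is open iff its inverse image under the projection is open in [Z].  For
   nonempty [Y] the projection is onto, so this is the quotient topology; for
   empty [Y] it is the topology of the disjoint union of [Z] and a point. *)
Definition pquot (Z : topologicalType) (Y : set Z) : Type := option (~` Y).

Section pquot.
Context {Z : topologicalType} (Y : set Z).

HB.instance Definition _ := Choice.copy (pquot Y) (option (~` Y)).

Definition pquot_pi (z : Z) : pquot Y := insub z.

Lemma pquot_pi_in (z : Z) : Y z -> pquot_pi z = None.
Proof. by move=> Yz; rewrite /pquot_pi insubN//; apply/negP => /set_mem /(_ Yz). Qed.

Lemma pquot_pi_notin (z : Z) (h : z \in ~` Y) :
  pquot_pi z = Some (exist _ z h).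
Proof. exact: insubT. Qed.

Definition pquot_open (U : set (pquot Y)) := open (pquot_pi @^-1` U).

Let pquot_openT : pquot_open setT.
Proof. by rewrite /pquot_open preimage_setT; exact: openT. Qed.

Let pquot_openI : setI_closed pquot_open.
Proof. by move=> U V; rewrite /pquot_open preimage_setI; exact: openI. Qed.

Let pquot_open_bigU (J : Type) (f : J -> set (pquot Y)) :
  (forall j, pquot_open (f j)) -> pquot_open (\bigcup_j f j).
Proof.
by move=> fo; rewrite /pquot_open preimage_bigcup; apply: bigcup_open => j _; exact: fo.
Qed.

HB.instance Definition _ := @isOpenTopological.Build (pquot Y)
  pquot_open pquot_openT pquot_openI pquot_open_bigU.
HB.instance Definition _ := isPointed.Build (pquot Y) None.

Lemma pquot_pi_continuous : continuous pquot_pi.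
Proof. exact/continuousP. Qed.

Lemma pquot_pi_surj : Y !=set0 -> range pquot_pi = setT.
Proof.
move=> [y Yy]; apply/seteqP; split=> // -[[z h]|] _; last first.
  by exists y => //; exact: pquot_pi_in.
by exists z => //; exact: pquot_pi_notin.
Qed.

End pquot.

Local Open Scope quotient_scope.

Section glue.
Context {Z : topologicalType} (r : Z -> Z -> Prop).

Definition gen_equiv : Z -> Z -> Prop :=
  Relation_Operators.clos_refl_sym_trans Z r.

Definition glue_rel : rel Z := fun x y => `[< gen_equiv x y >].

Let glue_refl : reflexive glue_rel.
Proof. by move=> x; apply/asboolP; exact: Relation_Operators.rst_refl. Qed.

Let glue_sym : symmetric glue_rel.
Proof. by move=> x y; apply/asboolP/asboolP => h; exact: Relation_Operators.rst_sym. Qed.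

Let glue_trans : transitive glue_rel.
Proof.
move=> y x z /asboolP xy /asboolP yz; apply/asboolP.
exact: Relation_Operators.rst_trans xy yz.
Qed.

Definition glue_equiv := EquivRel _ glue_refl glue_sym glue_trans.

Definition glue := quotient_topology {eq_quot glue_equiv}.
HB.instance Definition _ := Topological.on glue.
HB.instance Definition _ := Quotient.on glue.

Definition glue_pi (z : Z) : glue := \pi_({eq_quot glue_equiv}) z.

Lemma glue_piP (x y : Z) :
  glue_pi x = glue_pi y <-> gen_equiv x y.
Proof.
split; first by move/eqmodP/asboolP.
by move=> h; apply/eqmodP/asboolP.
Qed.

Lemma glue_pi_repr (w : glue) :
  glue_pi (repr w) = w.
Proof. exact: reprK. Qed.

Lemma glue_pi_continuous : continuous glue_pi.
Proof. exact: pi_continuous. Qed.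

End glue.

Definition phomotopic (R : realType) (P Q : ptopologicalType) (g h : P -> Q) :=
  exists H : P * I01 R -> Q,
    [/\ continuous H,
        forall p, H (p, zeroI R) = g p,
        forall p, H (p, oneI R) = h p &
        forall s, H (point, s) = point].

Definition same_phomotopy_type (R : realType) (P Q : ptopologicalType) :=
  exists (g : P -> Q) (h : Q -> P),
    [/\ continuous g /\ g point = point,
        continuous h /\ h point = point,
        phomotopic R (h \o g) idfun &
        phomotopic R (g \o h) idfun].

Section maps.
Context {X : topologicalType}.
Implicit Types (f : X -> X) (M S N L : set X).

Definition inv_map M f : set X :=
  [set x | exists g : int -> X,
    [/\ g 0 = x, forall n, M (g n) & forall n, g (n + 1) = f (g n)]].

Definition isolated_invariant S f :=
  compact S /\ exists M, S `<=` interior M /\ inv_map M f = S.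

Definition pair_quot N L : Type := pquot ([set z | L (val z)] : set N).
HB.instance Definition _ N L := PointedTopological.on (pair_quot N L).

Definition pair_class N L (x : X) : pair_quot N L :=
  if insub x is Some z then pquot_pi _ (z : N) else None.

Definition pair_map f N L (p : pair_quot N L) : pair_quot N L :=
  if p is Some z then pair_class N L (f (val (val z))) else None.
Arguments pair_map f N L p : clear implicits.

Lemma pair_class_base N L (x : X) : ~ (N `\` L) x -> pair_class N L x = point.
Proof.
move=> h; rewrite /pair_class; case: insubP => // z _ zx.
apply: pquot_pi_in => /=; apply: contrapT => nL.
by apply: h; split; rewrite -zx//; have /set_mem := valP z.
Qed.

Lemma pair_classE N L (z : N) :
  pair_class N L (val z) = pquot_pi [set z : N | L (val z)] z.
Proof. by rewrite /pair_class valK. Qed.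

Lemma pair_map_in f N L (x : X) : (N `\` L) x -> (N `\` L) (f x) ->
  pair_map f N L (pair_class N L x) = pair_class N L (f x).
Proof.
move=> [Nx Lx] _; rewrite /pair_class (insubT (mem N) (mem_set Nx)).
by rewrite (pquot_pi_notin (mem_set _)).
Qed.

Lemma pair_map_out f N L (x : X) : ~ ((N `\` L) x /\ (N `\` L) (f x)) ->
  pair_map f N L (pair_class N L x) = point.
Proof.
move=> h; have [xNL|/pair_class_base->//] := pselect ((N `\` L) x).
have -> : pair_map f N L (pair_class N L x) = pair_class N L (f x).
  case: xNL => Nx Lx; rewrite {1}/pair_class (insubT (mem N) (mem_set Nx)).
  by rewrite (pquot_pi_notin (mem_set _)).
by apply: pair_class_base => fx; apply: h.
Qed.

Definition index_pair_map S f N L :=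
  [/\ compact N, compact L & L `<=` N] /\
  [/\ inv_map (closure (N `\` L)) f = S,
      S `<=` interior (N `\` L) &
      continuous (pair_map f N L)].

End maps.

Arguments pair_map {X} f N L p.

Section tori.
Context (R : realType).

Definition torus_rel (X : topologicalType) (f : X -> X) :
    X * I01 R -> X * I01 R -> Prop :=
  fun p q => exists x, p = (x, oneI R) /\ q = (f x, zeroI R).

Definition mtorus (X : topologicalType) (f : X -> X) : Type :=
  glue (torus_rel f).
HB.instance Definition _ X f := Topological.on (@mtorus X f).
HB.instance Definition _ X f := Quotient.on (@mtorus X f).

Definition half_smash (P : ptopologicalType) (Y : topologicalType) : Type :=
  pquot ([set z | z.1 = point] : set (P * Y)).
HB.instance Definition _ P Y := PointedTopological.on (half_smash P Y).

Definition half_class (P : ptopologicalType) (p : P) (s : I01 R) :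
  half_smash P (I01 R) := pquot_pi _ (p, s).

Definition rtorus_rel (P : ptopologicalType) (k : P -> P) :
    half_smash P (I01 R) -> half_smash P (I01 R) -> Prop :=
  fun p q => exists x,
    p = half_class x (oneI R) /\ q = half_class (k x) (zeroI R).

Definition rmtorus (P : ptopologicalType) (k : P -> P) : Type :=
  glue (rtorus_rel k).
HB.instance Definition _ P k := Topological.on (@rmtorus P k).
HB.instance Definition _ P k :=
  isPointed.Build (@rmtorus P k) (glue_pi (rtorus_rel k) point).

End tori.

Arguments torus_rel R {X} f.
Arguments rtorus_rel R {P} k.
Arguments mtorus R {X} f.
Arguments rmtorus R {P} k.
Arguments half_class {R P} p s.

Section suspension.
Context (R : realType) (X : topologicalType) (f : X -> X).

Definition tclass (x : X) (s : I01 R) : mtorus R f :=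
  glue_pi (torus_rel R f) (x, s).

Definition flow_rep (z : X * I01 R) (t : R) : mtorus R f :=
  tclass (iter `|Num.floor (val z.2 + t)|%N f z.1) (fracI (val z.2 + t)).

(* Only times [t >= 0] matter; by [susp_flowE] the value does not depend on the
   representative of [w]. *)
Definition susp_flow (w : mtorus R f) (t : R) : mtorus R f :=
  flow_rep (repr w) t.

Lemma mkI_inj (r s : R) (hr : 0 <= r <= 1) (hs : 0 <= s <= 1) :
  r = s -> mkI hr = mkI hs.
Proof. by move=> rs; apply: val_inj. Qed.

Lemma susp_flowE (x : X) (s : I01 R) (t : R) : 0 <= t ->
  susp_flow (tclass x s) t =
  tclass (iter `|Num.floor (val s + t)|%N f x) (fracI (val s + t)).
Proof.
move=> t0; rewrite -[RHS]/(flow_rep (x, s) t) /susp_flow.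
have : gen_equiv (torus_rel R f) (repr (tclass x s)) (x, s).
  by apply/glue_piP; rewrite glue_pi_repr.
elim=> {x s} [_ _ [y [-> ->]]|//|a b _ ->//|a b c _ -> _ ->//].
rewrite /flow_rep /= add0r.
have f1 : Num.floor (1 + t) = 1 + Num.floor t by rewrite floorDzr ?int_num1 ?floor1.
have -> : `|Num.floor (1 + t)|%N = `|Num.floor t|%N.+1.
  by rewrite f1; move: (Num.floor t) (floor_ge0 t); case=> // n; rewrite t0.
rewrite iterSr; congr tclass; apply: mkI_inj.
by rewrite f1 intrD opprD addrACA subrr add0r.
Qed.

Definition suspension (A : set X) : set (mtorus R f) :=
  [set w | exists x s, A x /\ w = tclass x s].

End suspension.

Arguments susp_flow R {X} f w t.
Arguments suspension R {X} f A.

Section flows.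
Context (R : realType) (W : topologicalType).
(* A semiflow is a function of a real time, used at nonnegative times only. *)
Implicit Types (phi : W -> R -> W) (M S N L : set W).

Definition inv_flow M phi : set W :=
  [set x | exists g : R -> W,
    [/\ g 0 = x, forall s, M (g s) &
        forall s t, 0 <= t -> g (s + t) = phi (g s) t]].

Definition orbit_in phi (x : W) (t : R) M := forall s, 0 <= s <= t -> M (phi x s).

Definition index_pair_flow S phi N L :=
  [/\ compact N, compact L & L `<=` N] /\
  [/\ inv_flow (closure (N `\` L)) phi = S,
      S `<=` interior (N `\` L),
      forall x t, L x -> 0 < t -> orbit_in phi x t N -> orbit_in phi x t L &
      forall x t, N x -> 0 < t -> ~ N (phi x t) ->
        exists t', [/\ 0 <= t' <= t, L (phi x t') & orbit_in phi x t' N]].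

End flows.

(* Main.v *)
Require Import Defs.
From mathcomp Require Import all_boot all_order all_algebra.
From mathcomp Require Import all_classical all_reals all_analysis.
From mathcomp Require Import lra zify.

(* The reduced mapping torus of f_(N,L) and the quotient N'/L' both carry a
   semiflow fixing the base point: follow the suspension semiflow inside the
   given region and jump to the base point on leaving it.  By compactness there
   is T > 0 such that, in either region, an orbit staying there over [0, 2T] is
   at time T so close to the suspension of S that it lies in the other region.
   Hence "flow for time 3T, provided that [0, 2T] is spent in the first region
   and [T, 3T] in the second one, else go to the base point" defines continuous
   pointed maps in both directions; their composites are the time-6T maps of the
   two semiflows, which are homotopic to the identities.

   An index pair (N, L) of f comes from e-chains: N is the closure of what S
   reaches and L is the part of N from which S is no longer reached.  If the
   suspension of S has a compact neighbourhood, then f is proper near S, and an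
   index pair of the suspension semiflow is obtained by stacking N over [0, 1/2]
   and f^-1(N) over [1/2, 1], and likewise for L. *)

Set Implicit Arguments.
Unset Strict Implicit.
Unset Printing Implicit Defensive.

Import Order.TTheory GRing.Theory Num.Theory.
Import numFieldTopology.Exports.

Local Open Scope classical_set_scope.
Local Open Scope ring_scope.

(** * Limits along ultrafilters *)

Section ultrafilters.

(** The mapping torus of a non-proper map need be neither locally compact nor first countable, so
    neither compact neighbourhoods nor sequences are at hand. Continuity is therefore tested along
    ultrafilters: representatives are chosen in a compact set, they converge there, and their limit
    is identified because the target is Hausdorff. The obstacle in comparing the two spaces is the
    seam of the torus. Heights below 1 may tend to 1, so the region that models the reduced mapping
    torus is not open, and topologies are compared only at points that stay in a region for a time T
    before and after. The two time windows overlap in [T, 2T] so as to supply such points for both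
    regions: time T is the middle of the first window, time 2T the middle of the second. *)

Lemma filter_meet (T : Type) (F : set_system T) (A B : set T) :
  ProperFilter F -> F A -> F B -> exists x, A x /\ B x.
Proof.
by move=> PF FA FB; exact: (@filter_ex _ F) (filterI FA FB).
Qed.

Lemma ultra_fmap (T U : Type) (f : T -> U) (F : set_system T) :
  UltraFilter F -> UltraFilter (f @ F).
Proof.
move=> UF; split=> [|G PG FG]; first exact: fmap_proper_filter.
apply/seteqP; split=> // A GA; have [//|FA] := in_ultra_setVsetC (f @^-1` A) UF.
have /FG GnA : (f @ F) (~` A) by [].
by have [? []] := filter_meet PG GA GnA.
Qed.

(** The analogue of passing to a subsequence inside [A]. It yields both the reduction of convergence
    to ultrafilters and the description of closures by ultrafilters. *)
Lemma ultra_restrict (T : Type) (F : set_system T) (A : set T) : Filter F ->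
  ~ F (~` A) -> exists G, [/\ UltraFilter G, F `<=` G & G A].
Proof.
move=> FF FA; have PF : ProperFilter (within A F).
  split; last exact: within_filter.
  by move=> F0; apply: FA; apply: filterS F0 => x; exact.
have [G [UG FG]] := ultraFilterLemma PF; exists G; split=> //.
  by move=> B FB; apply: FG; apply: filterS FB.
by apply: FG; exact: withinT.
Qed.

Lemma ultra_cvg (T : Type) (U : topologicalType) (f : T -> U) (F : set_system T)
    (y : U) : Filter F ->
  (forall G, UltraFilter G -> F `<=` G -> f @ G --> y) -> f @ F --> y.
Proof.
move=> FF FG B By; apply: contrapT => nFB.
have [|G [UG sFG GB]] := @ultra_restrict _ F (f @^-1` (~` B)).
  by rewrite preimage_setC setCK.
by have [? []] := filter_meet _ GB (FG G UG sFG B By).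
Qed.

Lemma continuous_ultra (T U : topologicalType) (f : T -> U) :
  (forall x G, UltraFilter G -> G --> x -> f @ G --> f x) -> continuous f.
Proof. by move=> fG x; apply: ultra_cvg => G UG; exact: fG. Qed.

Lemma compact_ultra_cvg (T : topologicalType) (A : set T) (F : set_system T) :
  UltraFilter F -> compact A -> F A -> exists2 p, A p & F --> p.
Proof. by move=> UF; rewrite compact_ultra => /(_ F UF) h /h[p [Ap Fp]]; exists p. Qed.

Lemma ultra_compact (T : topologicalType) (A : set T) :
  (forall F, UltraFilter F -> F A -> exists2 p, A p & F --> p) -> compact A.
Proof.
by move=> h; rewrite compact_ultra => F UF /(h F UF)[p Ap Fp]; exists p.
Qed.

Lemma closed_lim (T : topologicalType) (A : set T) (F : set_system T)
    {PF : ProperFilter F} (p : T) :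
  closed A -> F A -> F --> p -> A p.
Proof.
move=> cA FA Fp; apply: cA => B /Fp FB.
exact: filter_meet FA FB.
Qed.

Lemma closureP_ultra (T : topologicalType) (A : set T) (p : T) :
  closure A p -> exists F, [/\ UltraFilter F, F A & F --> p].
Proof.
move=> cA; have [|F [UF sF FA]] := @ultra_restrict _ (nbhs p) A.
  by move=> /cA[x []].
by exists F.
Qed.

Lemma ultra_closed (T : topologicalType) (A : set T) :
  (forall F p, UltraFilter F -> F A -> F --> p -> A p) -> closed A.
Proof. by move=> h p /closureP_ultra[F [UF FA Fp]]; exact: h FA Fp. Qed.

Lemma hausdorff_lim (T : topologicalType) (F : set_system T)
    {PF : ProperFilter F} (p q : T) :
  hausdorff_space T -> F --> p -> F --> q -> p = q.
Proof. by move=> /cvg_unique; apply. Qed.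

Lemma set_type_cvg (T : topologicalType) (A : set T) (F : set_system A) (x : A) :
  Filter F -> val @ F --> val x -> F --> x.
Proof.
move=> FF Fx B; rewrite nbhsE => -[C [[D oD <-] Dx] DB].
by apply: (filterS DB); apply: Fx; apply: open_nbhs_nbhs.
Qed.

Lemma val_continuous (T : topologicalType) (A : set T) :
  continuous (val : A -> T).
Proof. exact: initial_continuous. Qed.

Lemma cvg_comp2 (T : Type) (U V : topologicalType) (F : set_system T)
    {FF : Filter F} (f : T -> U) (g : U -> V) (x : U) :
  f @ F --> x -> {for x, continuous g} -> (g \o f) @ F --> g x.
Proof. by move=> fx gx; exact: cvg_comp fx gx. Qed.

Lemma cvg_to_pair (T : Type) (U V : topologicalType) (F : set_system T)
    {FF : Filter F} (f : T -> U) (g : T -> V) (x : U) (y : V) :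
  f @ F --> x -> g @ F --> y -> (fun i => (f i, g i)) @ F --> (x, y).
Proof. by move=> fx gy; exact: (cvg_pair (G := nbhs x) (H := nbhs y) fx gy). Qed.

Lemma cvg_eq_on (T : Type) (U : topologicalType) (F : set_system T)
    {FF : Filter F} (A : set T) (f g : T -> U) (y : U) :
  F A -> (forall x, A x -> f x = g x) -> f @ F --> y -> g @ F --> y.
Proof.
move=> FA fg fy B /fy FB; have FAB : F (A `&` f @^-1` B) by exact: filterI.
by apply: (@filterS _ F) FAB => x [/fg fgx]; rewrite /preimage /= fgx.
Qed.

Lemma lim_fst (U V : topologicalType) (F : set_system (U * V)) (x : U) (y : V) :
  F --> (x, y) -> fst @ F --> x.
Proof. by move=> Fxy B Bx; apply: Fxy; exact: (@cvg_fst _ _ (nbhs x) (nbhs y)). Qed.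

Lemma lim_snd (U V : topologicalType) (F : set_system (U * V)) (x : U) (y : V) :
  F --> (x, y) -> snd @ F --> y.
Proof. by move=> Fxy B Bx; apply: Fxy; exact: (@cvg_snd _ _ (nbhs x) (nbhs y)). Qed.

Lemma I01_bounds (R : realType) (s : I01 R) : 0 <= val s <= 1.
Proof. by have /set_mem := valP s; rewrite /I01 /= in_itv. Qed.

Lemma hausdorff_near_neq (T : Type) (U : topologicalType) (F : set_system T)
    {FF : Filter F} (f : T -> U) (p q : U) :
  hausdorff_space U -> f @ F --> p -> p <> q -> F [set x | f x <> q].
Proof.
move=> hU fp pq; apply: (fp (~` [set q])); apply: open_nbhs_nbhs; split=> //.
exact/closed_openC/accessible_closed_set1/hausdorff_accessible.
Qed.

Lemma point_compact_separation (T : topologicalType) (L : set T) (x : T) :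
  hausdorff_space T -> compact L -> ~ L x ->
  exists A B, [/\ open A, open B, A x, L `<=` B & A `&` B = set0].
Proof.
move=> hT cL Lx.
have /compact_near_coveringP cov := cL.
(* The filter consists of the small neighbourhoods [W] of x. Each y in [L] avoids the closure of
   every small [W]; compactness of [L] makes one [W] work for all y. *)
have [|W [W1 W2 [M WM]] LW] := cov _ (powerset_filter_from (nbhs x))
    (fun W y => ~ closure W y).
- move=> y Ly; have /eqP xy : x <> y by move=> xy; apply: Lx; rewrite xy.
  move: hT; rewrite open_hausdorff => /(_ _ _ xy)[[U V]/= [/set_mem Ux /set_mem Vy]].
  move=> [oU oV /eqP UV]; exists (V, [set W | nbhs x W /\ W `<=` U]) => /=.
    split; first exact: open_nbhs_nbhs.
    exists [set W | nbhs x W /\ W `<=` U]; [split=> /=|by []].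
    - by move=> W [].
    - by move=> W W' [_ WU] nW' W'W; split=> //; exact: subset_trans WU.
    - by exists U; split=> //; exact: open_nbhs_nbhs.
  move=> [y' W]/= [Vy' [_ WU]] cW.
  have [|z [/WU Uz Vz]] := cW V; first exact: open_nbhs_nbhs.
  by have : set0 z by rewrite -UV.
- have xM := W1 _ WM; exists (interior M), (~` closure M); split.
  + exact: open_interior.
  + by apply: closed_openC; exact: closed_closure.
  + by [].
  + by move=> y /(LW _ WM).
  + by apply/seteqP; split=> // y [/interior_subset/subset_closure].
Qed.
End ultrafilters.

(** * Semiflows and full solutions *)

Section semiflow.
Context (R : realType).

(* As in [susp_flow], only the values at nonnegative times matter. *)
Record semiflow (W : topologicalType) (phi : W -> R -> W) : Prop := Semiflow {
  semiflow_continuous : continuous (fun z : W * R => phi z.1 (Num.max 0 z.2));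
  semiflow0 : forall w, phi w 0 = w;
  semiflowD : forall w s t, 0 <= s -> 0 <= t -> phi w (s + t) = phi (phi w s) t }.

Context (W : topologicalType) (phi : W -> R -> W).
Hypothesis phiP : semiflow phi.
Implicit Types (M O U : set W) (w x y : W) (s t T : R).

Lemma semiflow_lim (I : Type) (F : set_system I) {FF : Filter F} (v : I -> W)
    (t : I -> R) (w : W) (t0 : R) : v @ F --> w -> t @ F --> t0 ->
  (forall i, 0 <= t i) -> 0 <= t0 -> (fun i => phi (v i) (t i)) @ F --> phi w t0.
Proof.
move=> vw tt0 t_ge0 t0_ge0.
have vt : (fun i => (v i, t i)) @ F --> (w, t0) by exact: cvg_to_pair.
have : (fun i => phi (v i) (Num.max 0 (t i))) @ F --> phi w (Num.max 0 t0).
  exact: (cvg_comp2 vt (@semiflow_continuous _ _ phiP (w, t0))).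
by rewrite max_r//; under eq_fun do rewrite max_r//.
Qed.

Lemma semiflow_limc (I : Type) (F : set_system I) {FF : Filter F} (v : I -> W)
    (w : W) (t : R) : v @ F --> w -> 0 <= t -> (fun i => phi (v i) t) @ F --> phi w t.
Proof. by move=> vw t0; apply: (semiflow_lim vw) => //; exact: cvg_cst. Qed.

Lemma semiflow_time_continuous t : 0 <= t -> continuous (phi^~ t).
Proof. by move=> t0 w; apply: semiflow_limc => //; exact: cvg_id. Qed.

Lemma orbit_in_start w t U : 0 <= t -> orbit_in phi w t U -> U w.
Proof. by move=> t0 /(_ 0); rewrite (semiflow0 phiP) lexx t0; apply. Qed.

Lemma orbit_in_shift w s t u U : 0 <= s -> s + u <= t ->
  orbit_in phi w t U -> orbit_in phi (phi w s) u U.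
Proof.
move=> s0 sut wU r /andP[r0 ru]; rewrite -(semiflowD phiP)//; apply: wU.
by apply/andP; split; lra.
Qed.

Lemma orbit_in_le w s t U : s <= t -> orbit_in phi w t U -> orbit_in phi w s U.
Proof. by move=> st wU r /andP[r0 rs]; apply: wU; rewrite r0 (le_trans rs). Qed.

Lemma orbit_in_sub w t U M : U `<=` M -> orbit_in phi w t U -> orbit_in phi w t M.
Proof. by move=> UM wU r /wU /UM. Qed.

Lemma orbit_inD w s t U : 0 <= s -> 0 <= t ->
  orbit_in phi w s U -> orbit_in phi (phi w s) t U -> orbit_in phi w (s + t) U.
Proof.
move=> s0 t0 wsU wtU r /andP[r0 rst]; have [rs|sr] := leP r s.
  by apply: wsU; rewrite r0.
rewrite -(subrKC s r) (semiflowD phiP)//; last lra.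
by apply: wtU; apply/andP; split; lra.
Qed.

(* The points whose orbit can be followed inside [M] over the times [-T, T]. *)
Definition flow_core M T : set W :=
  [set phi x T | x in [set x | orbit_in phi x (T + T) M]].

Lemma flow_core_orbit M T x : orbit_in phi x (T + T) M -> flow_core M T (phi x T).
Proof. by exists x. Qed.

Lemma flow_core_anti M s t : 0 <= s <= t -> flow_core M t `<=` flow_core M s.
Proof.
move=> /andP[s0 st] _ [x xM <-]; exists (phi x (t - s)).
  by apply: orbit_in_shift xM; lra.
by rewrite -(semiflowD phiP) ?subrK//; lra.
Qed.

Hypothesis W_hausdorff : hausdorff_space W.

(** The points whose orbit stays in [M] over [0, 2T] form a closed subset of [M]; the core is its
    image under the time-T map. *)
Lemma flow_core_compact M T : compact M -> 0 <= T -> compact (flow_core M T).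
Proof.
move=> cM T0; apply: continuous_compact.
  by apply: continuous_subspaceT; exact: semiflow_time_continuous.
apply: (subclosed_compact _ cM); last first.
  by move=> x; apply: orbit_in_start; lra.
apply: ultra_closed => F x UF FM Fx s sT.
apply: (@closed_lim _ _ ((phi^~ s) @ F)).
- exact: compact_closed.
- by apply: (@filterS _ F) FM => y; exact.
- by apply: semiflow_limc => //; case/andP: sT.
Qed.

Lemma flow_core_closed M T : compact M -> 0 <= T -> closed (flow_core M T).
Proof. by move=> cM T0; apply: compact_closed => //; exact: flow_core_compact. Qed.

End semiflow.

Lemma compact_nested (T : topologicalType) (K : nat -> set T) (O : set T) :
  hausdorff_space T -> (forall n, compact (K n)) ->
  (forall m n, (m <= n)%N -> K n `<=` K m) -> open O ->
  \bigcap_n K n `<=` O -> exists n, K n `<=` O.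
Proof.
move=> hT cK anti oO KO; apply: contrapT => h.
have /choice[x xP] n : exists x, K n x /\ ~ O x.
  apply: contrapT => hx; apply: h; exists n => y Ky.
  by apply: contrapT => Oy; apply: hx; exists y.
have [F [UF sF]] := ultraFilterLemma eventually_filter.
have ev m : F [set n | (m <= n)%N] by apply: sF; exact: nbhs_infty_ge.
have FK m : (x @ F) (K m).
  by apply: (@filterS _ F) (ev m) => n /= mn; apply: (anti _ _ mn); have [] := xP n.
have [p K0p xp] := compact_ultra_cvg (ultra_fmap x UF) (cK 0%N) (FK 0%N).
have Op : O p.
  by apply: KO => m _; exact: closed_lim (compact_closed hT (cK m)) (FK m) xp.
have /xp /= FO : nbhs p O by exact: open_nbhs_nbhs.
have [n On] := @filter_ex _ F _ _ FO.
by have [_] := xP n.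
Qed.

Lemma compact_nested_nonempty (T : topologicalType) (K : nat -> set T) :
  hausdorff_space T -> (forall n, compact (K n)) ->
  (forall m n, (m <= n)%N -> K n `<=` K m) -> (forall n, K n !=set0) ->
  \bigcap_n K n !=set0.
Proof.
move=> hT cK anti K0; apply/set0P/negP => /eqP K00.
have [|n] := compact_nested hT cK anti open0; first by rewrite K00.
by have [x Kx] := K0 n => /(_ _ Kx).
Qed.

Section full_solutions.
Context (R : realType) (W : topologicalType) (phi : W -> R -> W).
Hypothesis phiP : semiflow phi.
Hypothesis W_hausdorff : hausdorff_space W.
Implicit Types (M O : set W).

(** Choose successive time-one predecessors y_n of y inside [A]. The value g(s) = phi(y_n, s + n) is
    the same for all n with s + n >= 0, because phi(y_(n+k), k) = y_n; [nb s] is one such n. *)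
Lemma full_solution_of_steps (A M : set W) (y : W) : A y ->
  (forall x, A x -> exists2 z, A z & phi z 1 = x) ->
  (forall x t, A x -> 0 <= t -> M (phi x t)) ->
  inv_flow M phi y.
Proof.
move=> Ay pre AM.
have /choice[prev prevP] x : exists z, A x -> A z /\ phi z 1 = x.
  have [/pre[z Az zx]|nA] := pselect (A x); first by exists z.
  by exists x => /nA.
have Ait n : A (iter n prev y) by elim: n => //= n /prevP[].
have itE n k : phi (iter (n + k) prev y) k%:R = iter n prev y.
  elim: k => [|k IH]; first by rewrite addn0 (semiflow0 phiP).
  rewrite -addn1 natrD addrC (semiflowD phiP)// addn1 addnS /=.
  by have [_ ->] := prevP _ (Ait (n + k)%N).
pose nb (s : R) := Num.bound `|s|.
pose g (s : R) := phi (iter (nb s) prev y) (s + (nb s)%:R).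
have bound_ge (s : R) : 0 <= s + (nb s)%:R.
  have := archi_boundP (normr_ge0 s); have := ler_norm (- s); rewrite normrN.
  by rewrite /nb; lra.
have gE (s : R) n : 0 <= s + n%:R -> g s = phi (iter n prev y) (s + n%:R).
  rewrite /g; move: (nb s) (bound_ge s) => m sm sn.
  wlog mn : m n sm sn / (m <= n)%N.
    by have [mn|/ltnW nm] := leqP m n; [|symmetry]; auto.
  rewrite -(subnKC mn) natrD -(itE m (n - m)%N) addrA addrC.
  by rewrite -(semiflowD phiP)// ler0n.
exists g; split.
- by rewrite (gE 0 0%N) ?addr0//= (semiflow0 phiP).
- by move=> s; apply: AM => //; exact: bound_ge.
- move=> s t t0; rewrite (gE (s + t) (nb s)); last first.
    by have := bound_ge s; lra.
  by rewrite /g -(semiflowD phiP)// addrAC.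
Qed.

(** The intersection of the cores satisfies the hypotheses of [full_solution_of_steps]. A point x of
    the core for n + 1 has a time-one predecessor in the core for n, and compactness gives one
    predecessor lying in all cores. Forward orbits stay in [M] up to time t because x lies in a core
    for some n > t. *)
Lemma flow_core_inv M : compact M ->
  \bigcap_n flow_core phi M n%:R `<=` inv_flow M phi.
Proof.
move=> cM y Ay; apply: (full_solution_of_steps Ay).
  move=> x Ax.
  pose K n := flow_core phi M n%:R `&` [set z | phi z 1 = x].
  have [|||z Kz] := @compact_nested_nonempty _ K W_hausdorff.
  - move=> n; apply: compact_closedI; first exact: flow_core_compact.
    apply: ultra_closed => F p UF /= FK Fp.
    have p1 : (fun i => phi i 1) @ F --> phi p 1 by exact: semiflow_limc.
    by apply: (hausdorff_lim W_hausdorff p1); apply: cvg_near_cst; exact: FK.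
  - move=> m n mn z [zn zx]; split=> //; apply: (flow_core_anti phiP) zn => //.
    by rewrite ler0n ler_nat.
  - move=> n; have [x' x'M x'x] := Ax n.+1 I.
    exists (phi x' n%:R); split; last first.
      by rewrite /= -(semiflowD phiP)// natr1.
    by apply: flow_core_orbit; apply: orbit_in_le x'M; rewrite -natr1; lra.
  - by exists z => [n _|]; [have [] := Kz n I|have [] := Kz 0%N I].
move=> x t Ax t0; have [x' x'M <-] := Ax (Num.bound t) I.
rewrite -(semiflowD phiP)//; apply: x'M; rewrite addr_ge0//=.
by rewrite lerD2l ltW// archi_boundP.
Qed.

Lemma flow_core_absorb M O : compact M -> open O -> inv_flow M phi `<=` O ->
  exists n : nat, flow_core phi M n%:R `<=` O.
Proof.
move=> cM oO MO; apply: compact_nested => //.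
- by move=> n; exact: flow_core_compact.
- by move=> m n mn; apply: flow_core_anti => //; rewrite ler0n ler_nat.
- by move=> y /(flow_core_inv cM)/MO.
Qed.

End full_solutions.

(** * Comparing two pointed spaces modelled on a semiflow *)

Section flow_models.
Context (R : realType) (W : topologicalType) (phi : W -> R -> W) (S : set W).
Implicit Types (P Q : ptopologicalType).

(* [P] consists of a base point and the points of a region [fm_dom] of [W]; the
   topologies of [P] and [W] need to agree only along [fm_core].  This set is not
   required to be open in [W]: for the reduced mapping torus, a point [x, s] with
   s close to 1 and f x close to S is close to the suspension of S, but it lies
   outside [fm_dom] when x is not in N. *)
Record flow_model P := FlowModel {
  fm_dom : set W;
  fm_core : set W;
  fm_hull : set W;
  fm_class : W -> P;
  fm_flow : P -> R -> P;
  fm_hausdorff : hausdorff_space P;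
  fm_core_dom : fm_core `<=` fm_dom;
  fm_dom_hull : fm_dom `<=` fm_hull;
  fm_hull_compact : compact fm_hull;
  fm_hull_inv : inv_flow fm_hull phi `<=` S;
  fm_class_out : forall w, fm_class w = point <-> ~ fm_dom w;
  fm_class_inj : forall w w', fm_dom w -> fm_dom w' ->
    fm_class w = fm_class w' -> w = w';
  fm_class_surj : forall p, p <> point -> exists2 w, fm_dom w & fm_class w = p;
  fm_semiflow : semiflow fm_flow;
  fm_flow_point : forall t, 0 <= t -> fm_flow point t = point;
  fm_flow_in : forall w t, 0 <= t -> orbit_in phi w t fm_dom ->
    fm_flow (fm_class w) t = fm_class (phi w t);
  fm_flow_out : forall w t, 0 <= t -> ~ orbit_in phi w t fm_dom ->
    fm_flow (fm_class w) t = point;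
  fm_class_cvg : forall (F : set_system W) w, UltraFilter F -> F fm_core ->
    fm_core w -> F --> w -> fm_class @ F --> fm_class w;
  fm_cvg_class : forall (F : set_system W) w, UltraFilter F -> F fm_dom ->
    fm_core w -> fm_class @ F --> fm_class w -> F --> w;
  fm_absorb : forall M, compact M -> inv_flow M phi `<=` S ->
    exists2 T, 0 <= T & flow_core phi M T `<=` fm_core }.

Arguments fm_hull_compact {P} f _ _ _.
Arguments fm_hausdorff {P} f _ _ _.

Hypothesis phiP : semiflow phi.
Hypothesis W_hausdorff : hausdorff_space W.

(** [fm_absorb] speaks of every compact set whose invariant part lies in [S], not only of the hull
    of its own model; this is what links two different models. *)
Lemma fm_absorb_hull P Q (A : flow_model P) (B : flow_model Q) :
  exists2 T, 0 <= T & forall t, T <= t -> flow_core phi (fm_hull A) t `<=` fm_core B.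
Proof.
have [T T0 TB] := fm_absorb B (fm_hull_compact A) (@fm_hull_inv _ A).
exists T => // t Tt; apply: subset_trans TB.
by apply: flow_core_anti => //; rewrite T0.
Qed.

Lemma fm_flow_neq P (A : flow_model P) p t : 0 <= t -> fm_flow A p t <> point ->
  exists w, [/\ fm_dom A w, fm_class A w = p & orbit_in phi w t (fm_dom A)].
Proof.
move=> t0 pt; have pN : p <> point by move=> p0; apply: pt; rewrite p0 fm_flow_point.
have [w wA wp] := fm_class_surj A pN; exists w; split=> //.
by apply: contrapT => nw; apply: pt; rewrite -wp fm_flow_out.
Qed.

Lemma fm_flow_orbit P (A : flow_model P) w t : 0 <= t -> fm_dom A w ->
  fm_flow A (fm_class A w) t <> point -> orbit_in phi w t (fm_dom A).
Proof.
move=> t0 wA /(fm_flow_neq t0)[w' [w'A w'w]].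
by rewrite (fm_class_inj w'A wA w'w).
Qed.

Lemma fm_class_neq P (A : flow_model P) w : fm_dom A w -> fm_class A w <> point.
Proof. by move=> wA /fm_class_out. Qed.

Lemma fm_section P (A : flow_model P) (w0 : W) : exists sec : P -> W,
  forall p, p <> point -> fm_dom A (sec p) /\ fm_class A (sec p) = p.
Proof.
have /choice[sec secP] p : exists w, p <> point -> fm_dom A w /\ fm_class A w = p.
  have [->|pN] := pselect (p = point); first by exists w0.
  by have [w wA wp] := fm_class_surj A pN; exists w.
by exists sec.
Qed.

Lemma fm_class_lim P (A : flow_model P) (I : Type) (F : set_system I)
    (v : I -> W) z : UltraFilter F -> F [set i | fm_core A (v i)] ->
  fm_core A z -> v @ F --> z -> (fun i => fm_class A (v i)) @ F --> fm_class A z.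
Proof. by move=> UF; exact: (fm_class_cvg (ultra_fmap v UF)). Qed.

Lemma fm_lim_class P (A : flow_model P) (I : Type) (F : set_system I)
    (v : I -> W) z : UltraFilter F -> F [set i | fm_dom A (v i)] ->
  fm_core A z -> (fun i => fm_class A (v i)) @ F --> fm_class A z -> v @ F --> z.
Proof. by move=> UF; exact: (fm_cvg_class (ultra_fmap v UF)). Qed.

Section transfer.
Context P Q (A : flow_model P) (B : flow_model Q) (T : R).

Definition transferable (w : W) :=
  orbit_in phi w (T + T) (fm_dom A) /\ orbit_in phi (phi w T) (T + T) (fm_dom B).

Definition transfer (p : P) : Q :=
  if pselect (exists w, fm_class A w = p /\ transferable w) is left h
  then fm_class B (phi (projT1 (cid h)) (T + (T + T))) else point.

Hypothesis T0 : 0 <= T.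

Lemma transferable_dom w : transferable w -> fm_dom A w.
Proof. by move=> [wA _]; apply: orbit_in_start wA => //; exact: addr_ge0. Qed.

Lemma transfer_in w : transferable w ->
  transfer (fm_class A w) = fm_class B (phi w (T + (T + T))).
Proof.
move=> wT; rewrite /transfer; case: pselect => [h|h]; last first.
  by exfalso; apply: h; exists w.
case: cid => /= w' [w'w w'T]; congr (fm_class B (phi _ _)).
by apply: (fm_class_inj _ _ w'w); exact: transferable_dom.
Qed.

Lemma transfer_out p : ~ (exists w, fm_class A w = p /\ transferable w) ->
  transfer p = point.
Proof. by rewrite /transfer; case: pselect. Qed.

Lemma transfer_point : transfer point = point.
Proof.
apply: transfer_out => -[w [w0 wT]].
by move/fm_class_out: w0; apply; exact: transferable_dom.
Qed.

Hypothesis AA : flow_core phi (fm_hull A) T `<=` fm_core A.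
Hypothesis AB : flow_core phi (fm_hull A) T `<=` fm_core B.
Hypothesis BA : flow_core phi (fm_hull B) T `<=` fm_core A.
Hypothesis BB : flow_core phi (fm_hull B) T `<=` fm_core B.

Let T2_ge0 : 0 <= T + T. Proof. exact: addr_ge0. Qed.

(** Convergence in [P] says nothing directly about representatives in [W], but after time T they lie
    in a compact set inside both cores, where the topologies agree. So the point that is followed is
    [v p'], the representative at time T, and [transfer] is read as the flow of [Q] for time 2T from
    the class of [v p']. *)
Lemma transfer_continuous : continuous transfer.
Proof.
apply: continuous_ultra => p F UF Fp.
pose G := [set p' | exists w, fm_class A w = p' /\ transferable w].
have hP := fm_hausdorff A; have hQ := fm_hausdorff B.
have [FG|FG] := in_ultra_setVsetC G UF.
  have [p0 [w0 _]] := @filter_ex _ F _ _ FG.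
  have [sec secP] := fm_section A w0.
  have FT : F [set p' | p' = fm_class A (sec p') /\ transferable (sec p')].
    apply: (@filterS _ F) FG => p' [w [wp wT]] /=.
    have wA := transferable_dom wT.
    have [|sA sp] := secP p'; first by rewrite -wp; exact: fm_class_neq.
    by have -> : sec p' = w by apply: (fm_class_inj sA wA); rewrite sp.
  pose v p' := phi (sec p') T.
  have vA : (v @ F) (flow_core phi (fm_hull A) T).
    apply: (@filterS _ F) FT => p' [_ [h _]]; apply: flow_core_orbit.
    exact: orbit_in_sub (@fm_dom_hull _ A) h.
  have [z zA vz] := compact_ultra_cvg (ultra_fmap v UF)
    (flow_core_compact phiP W_hausdorff (fm_hull_compact A) T0) vA.
  have zT : flow_core phi (fm_hull B) T (phi z T).
    apply: (@closed_lim _ _ ((fun p' => phi (v p') T) @ F)).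
    - by apply: flow_core_closed => //; exact: fm_hull_compact.
    - apply: (@filterS _ F) FT => p' [_ [_ h]]; apply: flow_core_orbit.
      exact: orbit_in_sub (@fm_dom_hull _ B) h.
    - by apply: semiflow_limc.
  have vB : F [set p' | fm_core A (phi (v p') T)].
    apply: (@filterS _ F) FT => p' [_ [_ h]]; apply/BA/flow_core_orbit.
    exact: orbit_in_sub (@fm_dom_hull _ B) h.
  have flowT : fm_flow A p T = fm_class A z.
    apply: (hausdorff_lim hP (semiflow_limc (fm_semiflow A) Fp T0)).
    have vAc : (v @ F) (fm_core A) by apply: (@filterS _ F) vA => p'; exact: AA.
    have := fm_class_lim UF vAc (AA zA) vz.
    apply: (cvg_eq_on FT) => p' [p'E [h _]]; rewrite [in RHS]p'E fm_flow_in//.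
    by apply: (orbit_in_le _ h); rewrite lerDl.
  have flow2T : fm_flow A p (T + T) = fm_class A (phi z T).
    apply: (hausdorff_lim hP (semiflow_limc (fm_semiflow A) Fp T2_ge0)).
    have vzT : (fun p' => phi (v p') T) @ F --> phi z T by exact: semiflow_limc.
    have := fm_class_lim UF vB (BA zT) vzT.
    apply: (cvg_eq_on FT) => p' [p'E [h _]].
    by rewrite {2}p'E fm_flow_in// /v (semiflowD phiP).
  (* Time 2T is the middle of the window [T, 3T] in [B], so [phi z T] lies in the core of [A]. Hence
     the flow carries p to a point other than the base point at time 2T, and p has a representative
     that stays in the region. *)
  have [|w [wA wp wT]] := @fm_flow_neq _ A p (T + T) T2_ge0.
    by rewrite flow2T; apply/fm_class_neq/fm_core_dom/BA.
  have wz : phi w T = z.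
    have wT' : orbit_in phi w T (fm_dom A) by apply: orbit_in_le wT; rewrite lerDl.
    apply: (@fm_class_inj _ A); first by apply: wT'; rewrite T0 lexx.
      exact/fm_core_dom/AA.
    by rewrite -flowT -wp fm_flow_in.
  (* This formula covers both cases: [fm_flow B] sends the class of z to the base point precisely
     when the orbit of z leaves the region of [B] within time 2T. *)
  have -> : transfer p = fm_flow B (fm_class B z) (T + T).
    have [zT2|zT2] := pselect (orbit_in phi z (T + T) (fm_dom B)).
      rewrite -wp transfer_in; last by split=> //; rewrite wz.
      by rewrite fm_flow_in// (semiflowD phiP)// wz.
    rewrite fm_flow_out// transfer_out// => -[w' [w'p w'T]]; apply: zT2.
    suff w'w : w' = w by rewrite -wz -w'w; case: w'T.
    by apply: (fm_class_inj (transferable_dom w'T) wA); rewrite w'p.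
  have : (fun p' => fm_flow B (fm_class B (v p')) (T + T)) @ F -->
      fm_flow B (fm_class B z) (T + T).
    apply: semiflow_limc => //; first exact: fm_semiflow.
    apply: (fm_class_lim UF _ (AB zA) vz).
    by apply: (@filterS _ F) vA => p'; exact: AB.
  apply: (cvg_eq_on FT) => p' [p'E p'T].
  by rewrite [in RHS]p'E transfer_in// fm_flow_in ?(semiflowD phiP)//; case: p'T.
(* If almost no nearby point is transferable, neither is p: to be transferable means that the flow
   of [P] up to time 2T, and then that of [Q] from the class at time T, avoid the base point, and
   this is an open condition. *)
rewrite transfer_out.
  apply: (cvg_eq_on FG) (cvg_cst _) => p' p'G; rewrite transfer_out//.
move=> [w [wp wT]].
have wA := transferable_dom wT; have [wTA wTB] := wT.
have zA : flow_core phi (fm_hull A) T (phi w T).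
  by apply: flow_core_orbit; exact: orbit_in_sub (@fm_dom_hull _ A) wTA.
have [sec secP] := fm_section A w.
pose v p' := phi (sec p') T.
have flow2T : F [set p' | fm_flow A p' (T + T) <> point].
  apply: (hausdorff_near_neq (p := fm_flow A p (T + T))).
  - exact: hP.
  - by apply: semiflow_limc => //; exact: fm_semiflow.
  - by rewrite -wp fm_flow_in//; apply: fm_class_neq; apply: wTA; rewrite T2_ge0 lexx.
have FT : F [set p' | [/\ fm_class A (sec p') = p', fm_dom A (sec p') &
    orbit_in phi (sec p') (T + T) (fm_dom A)]].
  apply: (@filterS _ F) flow2T => p' p'T.
  have p'N : p' <> point by move=> p'0; apply: p'T; rewrite p'0 fm_flow_point.
  have [sA sp] := secP _ p'N; split=> //.
  by apply: fm_flow_orbit => //; rewrite sp.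
have vA : F [set p' | flow_core phi (fm_hull A) T (v p')].
  apply: (@filterS _ F) FT => p' [_ _ h]; apply: flow_core_orbit.
  exact: orbit_in_sub (@fm_dom_hull _ A) h.
have orbitT w' : orbit_in phi w' (T + T) (fm_dom A) -> orbit_in phi w' T (fm_dom A).
  by apply: orbit_in_le; rewrite lerDl.
have vw : v @ F --> phi w T.
  apply: (fm_lim_class UF _ (AA zA)).
    by apply: (@filterS _ F) vA => p' /AA; exact: fm_core_dom.
  have : (fun p' => fm_flow A p' T) @ F --> fm_class A (phi w T).
    rewrite -(fm_flow_in T0 (orbitT _ wTA)) wp.
    by apply: semiflow_limc => //; exact: fm_semiflow.
  apply: (cvg_eq_on FT) => p' [p'E _ h].
  by rewrite -[in LHS]p'E fm_flow_in//; exact: orbitT.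
have eB : (fm_class B \o v) @ F --> fm_class B (phi w T).
  apply: (fm_class_lim UF _ (AB zA) vw).
  by apply: (@filterS _ F) vA => p'; exact: AB.
have flowB : F [set p' | fm_flow B (fm_class B (v p')) (T + T) <> point].
  apply: (hausdorff_near_neq (p := fm_flow B (fm_class B (phi w T)) (T + T))).
  - exact: hQ.
  - by apply: semiflow_limc => //; exact: fm_semiflow.
  - rewrite fm_flow_in//; apply: fm_class_neq; apply: wTB.
    by rewrite T2_ge0 lexx.
have [p' [p'G [p'A]]] := filter_meet _ FG (filterI vA (filterI FT flowB)).
move=> [[p'E p'dom p'T] p'B]; apply: p'G; exists (sec p'); split=> //.
split=> //; apply: fm_flow_orbit => //.
exact/fm_core_dom/AB.
Qed.

End transfer.

(** The composite asks for [A] on [0, 2T], [B] on [T, 3T] and [3T, 5T], and [A] on [4T, 6T]. The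
    stretch [2T, 4T] is then in [A] as well: these times are at distance at least T from the ends of
    [T, 5T], so the orbit is in the core of [A]. Conversely, [A] on [0, 6T] implies [B] on [T, 5T]
    in the same way. Thus the composite is nontrivial exactly where the time-6T map is. *)
Lemma transfer_comp P Q (A : flow_model P) (B : flow_model Q) T p : 0 <= T ->
  flow_core phi (fm_hull A) T `<=` fm_core B ->
  flow_core phi (fm_hull B) T `<=` fm_core A ->
  transfer B A T (transfer A B T p) = fm_flow A p (T + (T + T) + (T + (T + T))).
Proof.
move=> T0 AB BA; set U := T + (T + T).
have U0 : 0 <= U by rewrite /U; lra.
have [-> | pN] := pselect (p = point).
  by rewrite transfer_point// transfer_point// fm_flow_point// addr_ge0.
have [w wA <-] := fm_class_surj A pN.
have coreA M x s : T <= s -> orbit_in phi x (s + T) M -> flow_core phi M T (phi x s).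
  move=> Ts xM; exists (phi x (s - T)).
    by apply: orbit_in_shift xM => //; lra.
  by rewrite -(semiflowD phiP) ?subrK//; lra.
have [wU|wU] := pselect (orbit_in phi w (U + U) (fm_dom A)).
  have wB s : T <= s <= U + T + T -> fm_dom B (phi w s).
    move=> /andP[Ts sU]; apply/fm_core_dom/AB/coreA => //.
    apply: orbit_in_le (orbit_in_sub (@fm_dom_hull _ A) wU).
    by rewrite /U in sU *; lra.
  have wAB : transferable A B T w.
    split; first by apply: orbit_in_le wU; rewrite /U; lra.
    move=> s /andP[s0 sT]; rewrite -(semiflowD phiP)//; apply: wB.
    by rewrite /U; apply/andP; split; lra.
  rewrite transfer_in// fm_flow_in ?addr_ge0// transfer_in -?(semiflowD phiP)//.
  split; last first.
    rewrite -(semiflowD phiP)//; apply: orbit_in_shift wU => //; first lra.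
    by rewrite /U; lra.
  move=> s /andP[s0 sT]; rewrite -(semiflowD phiP)//; apply: wB.
  by rewrite /U; apply/andP; split; lra.
rewrite fm_flow_out ?addr_ge0//.
have [wAB|nAB] := pselect (transferable A B T w); last first.
  rewrite (@transfer_out _ _ A B T) ?transfer_point// => -[w' [w'w w'T]].
  apply: nAB; suff <- : w' = w by [].
  exact: (fm_class_inj (transferable_dom T0 w'T) wA w'w).
rewrite transfer_in// -/U transfer_out// => -[w' [w'w w'T]]; apply: wU.
have [wA2 wB2] := wAB.
have UB : fm_dom B (phi w U).
  rewrite /U (semiflowD phiP)//; last exact: addr_ge0.
  by apply: wB2; rewrite addr_ge0//= lexx.
have w'U : w' = phi w U := fm_class_inj (transferable_dom T0 w'T) UB w'w.
rewrite w'U in w'T; have [UB2 UA2] := w'T.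
have B4 : orbit_in phi (phi w T) (T + T + (T + T)) (fm_dom B).
  apply: orbit_inD => //; try exact: addr_ge0.
  by rewrite -(semiflowD phiP) ?addr_ge0.
rewrite (_ : U + U = T + T + (T + T + (T + T))); last by rewrite /U; lra.
apply: orbit_inD => //; try by rewrite ?addr_ge0.
apply: orbit_inD => //; try by rewrite ?addr_ge0.
  move=> s /andP[s0 sT]; rewrite -(semiflowD phiP)//; last exact: addr_ge0.
  rewrite (_ : T + T + s = T + (T + s)); last by lra.
  rewrite (semiflowD phiP)//; last exact: addr_ge0.
  apply/fm_core_dom/BA/coreA; first lra.
  apply: orbit_in_le (orbit_in_sub (@fm_dom_hull _ B) B4); lra.
rewrite -(semiflowD phiP) ?addr_ge0//.
rewrite (_ : T + T + (T + T) = U + T); last by rewrite /U; lra.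
by rewrite (semiflowD phiP).
Qed.

Lemma fm_flow_homotopic P (A : flow_model P) (g : P -> P) T : 0 <= T ->
  (forall p, g p = fm_flow A p T) -> phomotopic R g idfun.
Proof.
move=> T0 gE.
exists (fun z : P * I01 R => fm_flow A z.1 ((1 - val z.2) * T)); split.
- apply: continuous_ultra => -[p s] F UF Fps.
  have Fp := lim_fst Fps.
  have Fs : (val \o snd) @ F --> val s.
    by apply: (cvg_comp2 (lim_snd Fps)); exact: val_continuous.
  have I_ge (r : I01 R) : 0 <= (1 - val r) * T.
    have /andP[r0 r1] := I01_bounds r.
    by rewrite mulr_ge0// subr_ge0.
  apply: (semiflow_lim (fm_semiflow A) Fp) => [|i|]; try exact: I_ge.
  apply: cvgM; last exact: cvg_cst.
  by apply: cvgB; [exact: cvg_cst|exact: Fs].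
- by move=> p; rewrite gE /= subr0 mul1r.
- by move=> p; rewrite /= subrr mul0r (semiflow0 (fm_semiflow A)).
- move=> s; apply: fm_flow_point.
  have /andP[r0 r1] := I01_bounds s.
  by rewrite mulr_ge0// subr_ge0.
Qed.

Theorem flow_models_phomotopy P Q : flow_model P -> flow_model Q ->
  same_phomotopy_type R P Q.
Proof.
move=> A B.
have [T1 T10 hAA] := fm_absorb_hull A A; have [T2 T20 hAB] := fm_absorb_hull A B.
have [T3 T30 hBA] := fm_absorb_hull B A; have [T4 T40 hBB] := fm_absorb_hull B B.
(* The sum dominates each of the four absorption times. *)
pose T := T1 + T2 + (T3 + T4).
have T0 : 0 <= T by rewrite /T; lra.
have U0 : 0 <= T + (T + T) + (T + (T + T)) by lra.
have {}hAA := hAA T ltac:(rewrite /T; lra).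
have {}hAB := hAB T ltac:(rewrite /T; lra).
have {}hBA := hBA T ltac:(rewrite /T; lra).
have {}hBB := hBB T ltac:(rewrite /T; lra).
exists (transfer A B T), (transfer B A T); split.
- by split; [exact: transfer_continuous|exact: transfer_point].
- by split; [exact: transfer_continuous|exact: transfer_point].
- by apply: (fm_flow_homotopic (A := A) U0) => p; exact: transfer_comp.
- by apply: (fm_flow_homotopic (A := B) U0) => p; exact: transfer_comp.
Qed.

End flow_models.

(** * The mapping torus and the suspension semiflow *)

Section mapping_torus.
Context (R : realType) (X : topologicalType) (f : X -> X).
Hypothesis f_continuous : continuous f.
Implicit Types (x y : X) (s : I01 R) (t u : R).

Lemma I01_eq (s s' : I01 R) : val s = val s' -> s = s'.
Proof. exact: val_inj. Qed.

Lemma I01_compact : compact [set: I01 R].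
Proof.
apply: ultra_compact => F UF _.
have [|p pI Fp] := compact_ultra_cvg (ultra_fmap val UF) (@segment_compact R 0 1).
  by apply: (@filterS _ F) filterT => s _ /=; rewrite /preimage/= in_itv/= I01_bounds.
exists (exist _ p (mem_set pI)) => //; exact: set_type_cvg.
Qed.

Lemma clampI_proof t : 0 <= Num.min 1 (Num.max 0 t) <= 1.
Proof. by rewrite le_min ler01 le_max lexx/= ge_min lexx. Qed.

Definition clampI t : I01 R := mkI (clampI_proof t).

Lemma clampI_continuous : continuous clampI.
Proof.
apply: continuous_comp_initial => t /=.
have -> : set_val \o clampI = fun t => Num.min 1 (Num.max 0 t) by [].
apply: continuous_min; first exact: cst_continuous.
by apply: continuous_max; [exact: cst_continuous|exact: cvg_id].
Qed.

Lemma clampI_val t : 0 <= t <= 1 -> val (clampI t) = t.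
Proof. by move=> /andP[t0 t1] /=; rewrite max_r// min_r. Qed.

Lemma tclass_glue x : tclass f x (oneI R) = tclass f (f x) (zeroI R).
Proof.
by apply/glue_piP; apply: Relation_Operators.rst_step; exists x.
Qed.

Lemma tclass_continuous : continuous (fun z : X * I01 R => tclass f z.1 z.2).
Proof.
have -> : (fun z : X * I01 R => tclass f z.1 z.2) = glue_pi (torus_rel R f).
  by apply/funext => -[].
exact: glue_pi_continuous.
Qed.

Lemma tclass_lim (I : Type) (F : set_system I) {FF : Filter F} (v : I -> X)
    (s : I -> I01 R) (x : X) (s0 : I01 R) : v @ F --> x -> s @ F --> s0 ->
  (fun i => tclass f (v i) (s i)) @ F --> tclass f x s0.
Proof.
move=> vx ss; have vs : (fun i => (v i, s i)) @ F --> (x, s0) by exact: cvg_to_pair.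
exact: (cvg_comp2 vs (tclass_continuous (x := (x, s0)))).
Qed.

(** The representative of height below 1. It turns the generated equivalence relation into an
    equality of normal forms. *)
Definition torus_normal (z : X * I01 R) : X * I01 R :=
  if val z.2 == 1 then (f z.1, zeroI R) else z.

Lemma torus_normalP (z : X * I01 R) : val (torus_normal z).2 < 1.
Proof.
rewrite /torus_normal; case: eqP => [_|/eqP s1]; first exact: ltr01.
by rewrite lt_neqAle s1; case/andP: (I01_bounds z.2).
Qed.

Lemma torus_normal_id z : val z.2 < 1 -> torus_normal z = z.
Proof. by rewrite /torus_normal lt_neqAle => /andP[/negbTE ->]. Qed.

Lemma torus_normal_one x s : val s = 1 -> torus_normal (x, s) = (f x, zeroI R).
Proof. by rewrite /torus_normal /= => ->; rewrite eqxx. Qed.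

Lemma tclass_normal z : tclass f (torus_normal z).1 (torus_normal z).2 = tclass f z.1 z.2.
Proof.
rewrite /torus_normal; case: eqP => //= z1; rewrite -tclass_glue.
by congr tclass; exact: I01_eq.
Qed.

Lemma tclass_eq x s y s' :
  tclass f x s = tclass f y s' <-> torus_normal (x, s) = torus_normal (y, s').
Proof.
split=> [/glue_piP|h]; last first.
  by rewrite -(tclass_normal (x, s)) -(tclass_normal (y, s')) h.
elim=> [_ _ [z [-> ->]]|//|a b _ ->//|a b c _ -> _ ->//].
by rewrite torus_normal_one// torus_normal_id//= ltr01.
Qed.

Lemma tclass_inj x s y s' : val s < 1 -> val s' < 1 ->
  tclass f x s = tclass f y s' -> x = y /\ s = s'.
Proof. by move=> s1 s'1 /tclass_eq; rewrite !torus_normal_id// => -[]. Qed.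

Lemma tclass_surj (w : mtorus R f) : exists x s, val s < 1 /\ w = tclass f x s.
Proof.
rewrite -(glue_pi_repr w); move: (repr w) => -[x s].
have := torus_normalP (x, s); have := tclass_normal (x, s).
case: (torus_normal _) => y s' /= ys s'1; by exists y, s'; rewrite ys.
Qed.

Lemma open_mtorus (G : set (mtorus R f)) :
  open G <-> open [set z : X * I01 R | G (tclass f z.1 z.2)].
Proof.
have -> : [set z : X * I01 R | G (tclass f z.1 z.2)] = glue_pi (torus_rel R f) @^-1` G.
  by apply/seteqP; split => -[].
by [].
Qed.

Lemma open_torus_saturated (G : set (X * I01 R)) :
  open G -> (forall x, G (x, oneI R) <-> G (f x, zeroI R)) ->
  exists2 H : set (mtorus R f), open H & forall x s, H (tclass f x s) <-> G (x, s).
Proof.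
move=> oG Gsat; have Gn z : G (torus_normal z) <-> G z.
  rewrite /torus_normal; case: z => x s /=; case: eqP => // s1.
  by rewrite -Gsat (_ : oneI R = s)//; exact: I01_eq.
pose H := [set w : mtorus R f | G (repr w)].
have HE x s : H (tclass f x s) <-> G (x, s).
  rewrite /H /=; case E : (repr _) => [y s'].
  have : tclass f y s' = tclass f x s.
    by rewrite -[RHS](glue_pi_repr) E.
  by rewrite -Gn -(Gn (x, s)) => /tclass_eq ->.
exists H => //; apply/open_mtorus; rewrite (_ : mkset _ = G)//.
by apply/seteqP; split => -[x s] /HE.
Qed.

Lemma open_val_lt (G : set R) : open G -> open [set s : I01 R | G (val s)].
Proof. by move=> oG; exact: (open_comp (fun s _ => @val_continuous _ _ s) oG). Qed.

(** A box that avoids the seam is saturated. At height 0 the box over [V] has to be completed by a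
    layer over f^-1(V) just below height 1, whence the second alternative. *)
Lemma torus_nbhd x s (V : set X) (e : R) : open V -> V x -> 0 < e -> val s < 1 ->
  exists H : set (mtorus R f), [/\ open H, H (tclass f x s) &
    forall x' s', H (tclass f x' s') ->
      (V x' /\ val s - e < val s' < val s + e) \/
      (val s = 0 /\ V (f x') /\ 1 - e < val s')].
Proof.
move=> oV Vx e0 /= s1; have /= /andP[s0 _] := I01_bounds s.
have oI (a b : R) : open [set r : R | a < r < b].
  rewrite (_ : mkset _ = `]a, b[%classic); first exact: interval_open.
  by apply/seteqP; split => r; rewrite /= in_itv.
have oG (A : set X) (a b : R) : open A ->
    open [set z : X * I01 R | A z.1 /\ a < val z.2 < b].
  move=> oA; apply: (openI (A := [set z : X * I01 R | A z.1])).
    by apply: (@open_comp _ _ fst) => // z _; exact: cvg_fst.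
  apply: (@open_comp _ _ snd [set r : I01 R | a < val r < b]).
    by move=> z _; exact: cvg_snd.
  exact: open_val_lt (oI a b).
have /= [s_gt0|s_le0] := ltP 0 (val s).
  (* The box has to miss the heights 0 and 1, where points are glued. *)
  pose e' := Num.min e (Num.min (sval s) (1 - sval s)).
  have e'0 : 0 < e' by rewrite !lt_min e0 s_gt0 subr_gt0.
  have [e'e e's e's1] : [/\ e' <= e, e' <= sval s & e' <= 1 - sval s].
    by rewrite /e' !ge_min !lexx !orbT.
  have [x'|H oH HE] := open_torus_saturated (oG V (val s - e') (val s + e') oV).
    by split=> -[_ /= /andP[]]; lra.
  exists H; split=> //; first by apply/HE; split=> //=; apply/andP; split; lra.
  move=> x' s' /HE [Vx' /= /andP[h1 h2]]; left; split=> //=.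
  by apply/andP; split; lra.
have s_eq0 : sval s = 0 by apply/eqP; rewrite eq_le s_le0.
(* The bound 1/2 keeps the lower layer away from height 1 and the upper layer away from height 0;
   the upper limit 2 used below is no restriction. *)
pose e' := Num.min e (1 / 2).
have e'0 : 0 < e' by rewrite lt_min e0 divr_gt0.
have [e'e e'2] : e' <= e /\ e' <= 1 / 2 by rewrite /e' !ge_min !lexx !orbT.
have oVf : open (f @^-1` V) by apply: open_comp => // x' _; exact: f_continuous.
have [x'|H oH HE] :=
    open_torus_saturated (openU (oG V (- e') e' oV) (oG _ (1 - e') 2 oVf)).
  split=> -[] [/= Vx' /andP[h1 h2]]; try lra.
    by left; split=> //=; apply/andP; split; lra.
  by right; split=> //=; apply/andP; split; lra.
exists H; split=> //.
  by apply/HE; left; split=> //=; apply/andP; split; lra.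
move=> x' s' /HE [[Vx' /= /andP[h1 h2]]|[Vx' /= /andP[h1 h2]]]; [left|right].
  by split=> //=; apply/andP; split; lra.
by split=> //; split=> //=; lra.
Qed.

(** A neighbourhood of a point at height 0 has a second piece above height 1 - e; an arc about [a]
    has to stay below it. *)
Lemma arc_gap (a b r e : R) : e + e <= 1 - a -> e + e <= 1 - b ->
  a - e < r < a + e -> b = 0 -> 1 - e < r -> False.
Proof. by move=> h1 h2 /andP[h3 h4] h5 h6; lra. Qed.

Lemma arcs_apart (a b r e : R) : 0 < e -> a - e < r < a + e -> b - e < r < b + e ->
  e + e <= a - b \/ e + e <= b - a -> False.
Proof. by move=> h0 /andP[h1 h2] /andP[h3 h4] [h|h]; lra. Qed.

(** Points are separated by height, or in [X] when their heights agree. The radius must also leave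
    room below height 1, because neighbourhoods at height 0 wrap round to the top; two such upper
    layers are separated through their images under f. *)
Lemma mtorus_hausdorff : hausdorff_space X -> hausdorff_space (mtorus R f).
Proof.
move=> hX; rewrite open_hausdorff => p q.
have [x [s [s1 ->]]] := tclass_surj p; have [y [t [t1 ->]]] := tclass_surj q.
have /andP[s0 _] := I01_bounds s; have /andP[t0 _] := I01_bounds t.
move=> /eqP pq.
suff [V [V' [e [[oV Vx oV' Vy] e0 [es et disj]]]]] : exists V V' e,
    [/\ [/\ open V, V x, open V' & V' y], 0 < e &
    [/\ e + e <= 1 - val s, e + e <= 1 - val t &
     (val s = val t /\ forall u : X, V u -> V' u -> False) \/
     (e + e <= val s - val t \/ e + e <= val t - val s)]].
  have [H [oH Hx HE]] := torus_nbhd oV Vx e0 s1.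
  have [H' [oH' Hy H'E]] := torus_nbhd oV' Vy e0 t1.
  exists (H, H'); first by split; exact: mem_set.
  split=> //; apply/eqP/seteqP; split=> // w [].
  have [z [r [r1 ->]]] := tclass_surj w.
  have gap := @arc_gap (val s) (val t) (val r) e es et.
  have gap' := @arc_gap (val t) (val s) (val r) e et es.
  have ap := @arcs_apart (val s) (val t) (val r) e e0.
  move=> /HE[[Vz zs]|[s_0 [Vz zs]]] /H'E[[V'z zt]|[t_0 [V'z zt]]].
  - by case: disj => [[_ VV']|disj]; [exact: VV' Vz V'z|exact: ap disj].
  - exact: gap.
  - exact: gap'.
  - case: disj => [[_ VV']|]; first exact: VV' Vz V'z.
    by rewrite s_0 t_0 subrr => -[]; rewrite leNgt addr_gt0.
have [st|st] := eqVneq (val s) (val t); last first.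
  exists setT, setT, (Num.min (Num.min (1 - val s) (1 - val t)) `|val s - val t| / 2).
  set m := Num.min _ _; have : m <= 1 - val s /\ m <= 1 - val t /\ m <= `|val s - val t|.
    by rewrite /m !ge_min !lexx !orbT.
  move=> [ms [mt mst]].
  have m0 : 0 < m by rewrite !lt_min !subr_gt0 s1 t1 normr_gt0 subr_eq0.
  split; [split=> //; exact: openT|lra|split; [lra|lra|right]].
  have [h|h] := lerP (val t) (val s); move: mst.
    by rewrite ger0_norm ?subr_ge0// => mst; left; lra.
  by rewrite ltr0_norm ?subr_lt0// => mst; right; lra.
have xy : x != y.
  by apply/eqP => xy; apply: pq; rewrite xy; congr tclass; exact: I01_eq.
move: hX; rewrite open_hausdorff => /(_ _ _ xy)[[V V']/= [/set_mem Vx /set_mem Vy]].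
move=> [oV oV' /eqP VV'].
have disj (u : X) : V u -> V' u -> False.
  by move=> Vu V'u; have : set0 u by rewrite -VV'.
exists V, V', ((1 - sval s) / 2); clear VV'; rewrite /= in s1 st.
by split; [split|lra|split; [lra|lra|left]].
Qed.

Definition torus_orbit x u : mtorus R f := tclass f (iter `|Num.floor u|%N f x) (fracI u).

Lemma susp_flow_orbit x s t : 0 <= t ->
  susp_flow R f (tclass f x s) t = torus_orbit x (val s + t).
Proof. exact: susp_flowE. Qed.

(** The closed interval matters: at u = n + 1 two consecutive pieces agree by the gluing, and this
    overlap gives continuity in time. *)
Lemma torus_orbit_piece x u n : n%:R <= u <= n.+1%:R ->
  torus_orbit x u = tclass f (iter n f x) (clampI (u - n%:R)).
Proof.
move=> /andP[nu un]; rewrite /torus_orbit.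
have [un1|un1] := ltP u n.+1%:R.
  have fu : Num.floor u = n%:Z.
    by apply/floor_def; rewrite nu intrD /= natr1.
  rewrite fu absz_nat; congr tclass; apply: I01_eq.
  rewrite clampI_val /= ?fu//; apply/andP; rewrite -natr1 in un; split; lra.
have {un un1} -> : u = n.+1%:R by apply/eqP; rewrite eq_le un.
have fu : Num.floor (n.+1%:R : R) = n.+1%:Z by apply/floor_def; rewrite -pmulrn lexx /= intrD -pmulrn ltrDl ltr01.
have -> : clampI (n.+1%:R - n%:R) = oneI R.
  by apply: I01_eq; rewrite clampI_val -natr1 addrAC subrr add0r//= ler01 lexx.
rewrite tclass_glue -iterS fu absz_nat; congr tclass; apply: I01_eq.
by rewrite /= fu subrr.
Qed.

Lemma nat_floor u : 0 <= u -> exists n : nat, n%:R <= u < n.+1%:R.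
Proof.
move=> u0; exists (Num.truncn u); exact: truncn_itv.
Qed.

Lemma torus_orbit_shift x u n : 0 <= u ->
  torus_orbit (iter n f x) u = torus_orbit x (u + n%:R).
Proof.
move=> /nat_floor[m /andP[mu um]].
rewrite (@torus_orbit_piece _ _ m) ?mu ?(ltW um)// (@torus_orbit_piece _ _ (m + n)%N).
  by rewrite iterD natrD opprD addrACA subrr addr0.
by rewrite -addSn !natrD !lerD2r mu ltW.
Qed.

Lemma torus_orbit_tclass x u : 0 <= u -> exists n s,
  [/\ torus_orbit x u = tclass f (iter n f x) s, u = n%:R + val s & val s < 1].
Proof.
move=> /nat_floor[n /andP[nu un]]; exists n, (clampI (u - n%:R)).
rewrite -natr1 in un; rewrite clampI_val; last by apply/andP; split; lra.
split; [|by rewrite subrKC|by lra].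
by apply: torus_orbit_piece; rewrite nu -natr1 ltW.
Qed.

Lemma torus_orbit_frac x s : torus_orbit x (val s) = tclass f x s.
Proof.
have /andP[s0 s1] := I01_bounds s.
rewrite (@torus_orbit_piece _ _ 0) ?s0//= subr0; congr tclass.
by apply: I01_eq; rewrite clampI_val// s0.
Qed.

Lemma iter_continuous n : continuous (iter n f).
Proof.
elim: n => [|n IH] x; first exact: cvg_id.
by apply: continuous_comp; [exact: IH|exact: f_continuous].
Qed.

Lemma torus_orbit_lim (I : Type) (F : set_system I) {FF : Filter F} (v : I -> X)
    (u : I -> R) (x : X) (u0 : R) : v @ F --> x -> u @ F --> u0 ->
  (forall i, 0 <= u i) -> 0 <= u0 ->
  (fun i => torus_orbit (v i) (u i)) @ F --> torus_orbit x u0.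
Proof.
move=> vx uu0 u_ge0 u0_ge0; apply: ultra_cvg => G UG FG.
have {}vx : v @ G --> x by move=> B /vx; exact: FG.
have {}uu0 : u @ G --> u0 by move=> B /uu0; exact: FG.
(* Most [u i] lie in one closed unit interval that also contains [u0], and on it a single continuous
   formula describes the orbit. When [u0] is an integer, the ultrafilter decides from which side it
   is approached. *)
suff [k [kG ku0]] : exists k, G [set i | k%:R <= u i <= k.+1%:R] /\ k%:R <= u0 <= k.+1%:R.
  rewrite (torus_orbit_piece _ ku0).
  apply: (cvg_eq_on kG (f := fun i => tclass f (iter k f (v i)) (clampI (u i - k%:R)))).
    by move=> i /torus_orbit_piece ->.
  apply: tclass_lim; first exact: (cvg_comp2 vx (@iter_continuous k x)).
  apply: (cvg_comp2 (f := fun i => u i - k%:R)); last exact: clampI_continuous.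
  by apply: cvgB => //; exact: cvg_cst.
have [n /andP[nu un]] := nat_floor u0_ge0.
have Gun : G [set i | u i < n.+1%:R].
  exact: (cvgr_lt _ uu0).
have [Gn|Gn] := in_ultra_setVsetC [set i | n%:R <= u i] UG.
  exists n; split; last by rewrite nu ltW.
  by apply: (@filterS2 _ G) Gn Gun => i /= -> /ltW ->.
have u0n : u0 <= n%:R.
  apply: (@closed_lim _ [set r : R | r <= n%:R] (u @ G)) uu0.
    exact: closed_le.
  by apply: (@filterS _ G) Gn => i /= /negP; rewrite -ltNge => /ltW.
case: n nu un Gun Gn u0n => [|n] nu un Gun Gn u0n.
  have [i] := @filter_ex _ G _ _ Gn.
  by move=> /= /(_ (u_ge0 i)).
exists n; split; last by rewrite u0n (le_trans _ nu)// ler_nat.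
have Gn' : G [set i | n%:R < u i].
  by apply: (cvgr_gt _ uu0); rewrite (lt_le_trans _ nu)// ltr_nat.
apply: (@filterS2 _ G) Gn Gn' => i /= /negP; rewrite -ltNge => /ltW -> /ltW ->.
by [].
Qed.

(* The tube lemma: the product of the projection onto the mapping torus with the
   identity of the locally compact space [R] is again a quotient map. *)
Lemma susp_flow_continuous :
  continuous (fun z : mtorus R f * R => susp_flow R f z.1 (Num.max 0 z.2)).
Proof.
pose sigma (z : (X * I01 R) * R) := torus_orbit z.1.1 (val z.1.2 + Num.max 0 z.2).
have arg_ge0 (s : I01 R) t : 0 <= val s + Num.max 0 t.
  by rewrite addr_ge0 ?le_max ?lexx//; case/andP: (I01_bounds s).
have sigmaE x s t : susp_flow R f (tclass f x s) (Num.max 0 t) = sigma ((x, s), t).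
  by rewrite susp_flow_orbit// le_max lexx.
have sigma_continuous : continuous sigma.
  apply: continuous_ultra => -[[x s] t] F UF Fz.
  have Fxs := lim_fst Fz; have Ft := lim_snd Fz.
  have Fx : (fun z => z.1.1) @ F --> x by exact: (lim_fst Fxs).
  have Fs : (fun z => z.1.2) @ F --> s by exact: (lim_snd Fxs).
  apply: torus_orbit_lim => //.
  apply: cvgD; first by apply: (cvg_comp2 Fs); exact: val_continuous.
  apply: (cvg_comp2 (g := fun r : R => Num.max 0 r) Ft).
  by apply: continuous_max; [exact: cst_continuous|exact: cvg_id].
move=> [w0 t0] G0; rewrite nbhsE => -[G [oG Gw0] GG0] /=.
have [x0 [s0 [_ w0E]]] := tclass_surj w0; subst w0.
have [d d0 dG] : exists2 d : R, 0 < d & forall t, t0 - d <= t <= t0 + d ->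
    G (sigma ((x0, s0), t)).
  have /(_ G) : (fun t => sigma ((x0, s0), t)) @ nbhs t0 --> sigma ((x0, s0), t0).
    apply: (cvg_comp2 (f := fun t => ((x0, s0), t))); last exact: sigma_continuous.
    by apply: cvg_to_pair; [exact: cvg_cst|exact: cvg_id].
  case; first by apply: open_nbhs_nbhs; split=> //; rewrite -sigmaE.
  move=> d /= d0 dG; exists (d / 2); first by rewrite divr_gt0.
  move=> t /andP[t1 t2]; apply: dG; rewrite /ball /= ltr_norml.
  by apply/andP; split; lra.
pose C := `[t0 - d, t0 + d]%classic.
pose H := [set w | forall t, C t -> G (susp_flow R f w (Num.max 0 t))].
have oH : open H.
  apply/open_mtorus; rewrite openE => -[x s] Hz.
  have /compact_near_coveringP cov : compact C by exact: segment_compact.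
  have : \forall z \near ((x, s) : X * I01 R), C `<=` (fun t => G (sigma (z, t))).
    apply: (cov _ (nbhs ((x, s) : X * I01 R)) (fun z t => G (sigma (z, t)))) => t Ct.
    have Gz : nbhs (sigma ((x, s), t)) G.
      by apply: open_nbhs_nbhs; split=> //; rewrite -sigmaE; exact: Hz.
    have [[A B] /= [nA nB] AB] := sigma_continuous ((x, s), t) G Gz.
    by exists (B, A) => //= -[t' z] /= [Bt' Az]; apply: (AB (z, t')).
  by apply: filterS => -[x' s'] h t Ct /=; rewrite sigmaE; exact: h.
have nC : nbhs t0 C.
  exists d => //= t; rewrite /ball/= ltr_norml => /andP[h1 h2].
  by rewrite /C /= in_itv/=; apply/andP; split; lra.
have nH : nbhs (tclass f x0 s0) H.
  apply: open_nbhs_nbhs; split=> // t; rewrite /C /= in_itv/= => /dG.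
  by rewrite sigmaE.
by exists (H, C) => //= -[w t] /= [Hw Ct]; apply: GG0; exact: Hw.
Qed.

Lemma susp_semiflow : semiflow (susp_flow R f).
Proof.
split; first exact: susp_flow_continuous.
  move=> w; have [x [s [_ ->]]] := tclass_surj w.
  by rewrite susp_flow_orbit// addr0 torus_orbit_frac.
move=> w s t s0 t0; have [x [r [_ ->]]] := tclass_surj w.
have /andP[r0 _] := I01_bounds r.
rewrite (susp_flow_orbit x r (addr_ge0 s0 t0)) (susp_flow_orbit x r s0).
have [n [r' [-> nr' _]]] := torus_orbit_tclass x (addr_ge0 r0 s0).
have /andP[r'0 _] := I01_bounds r'.
rewrite susp_flow_orbit// torus_orbit_shift ?addr_ge0//.
by rewrite addrA nr' -addrA addrC.
Qed.

End mapping_torus.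

(** * Pointed quotients and the reduced mapping torus *)

Lemma hausdorff_inj (T U : topologicalType) (j : T -> U) :
  continuous j -> injective j -> hausdorff_space U -> hausdorff_space T.
Proof.
move=> cj ij; rewrite !open_hausdorff => hU x y xy.
have /hU[[A B]/= [/set_mem Ax /set_mem By] [oA oB /eqP AB]] : j x != j y.
  by apply: contra_neq xy; exact: ij.
exists (j @^-1` A, j @^-1` B) => /=; first by split; exact: mem_set.
split; [exact: open_comp|exact: open_comp|].
by rewrite -preimage_setI AB preimage_set0.
Qed.

Section pointed_quotients.
Context (Z : topologicalType) (Y : set Z).

Lemma pquot_piP (z z' : Z) : pquot_pi Y z = pquot_pi Y z' -> z = z' \/ (Y z /\ Y z').
Proof.
have [Yz|/mem_set zY] := pselect (Y z); have [Yz'|/mem_set z'Y] := pselect (Y z').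
- by right.
- by rewrite pquot_pi_in// pquot_pi_notin.
- by rewrite (pquot_pi_notin zY) pquot_pi_in.
- by rewrite (pquot_pi_notin zY) (pquot_pi_notin z'Y) => -[->]; left.
Qed.

Lemma pquot_open_some (A : set Z) : open A -> (forall z, A z -> ~ Y z) ->
  open [set p : pquot Y | if p is Some z then A (val z) else False].
Proof.
move=> oA AY; rewrite /open /= /pquot_open (_ : _ @^-1` _ = A)//.
apply/seteqP; split=> z /=; have [Yz|/mem_set zY] := pselect (Y z).
- by rewrite pquot_pi_in.
- by rewrite (pquot_pi_notin zY).
- by move=> /AY.
- by rewrite (pquot_pi_notin zY).
Qed.

Lemma pquot_open_base (A : set Z) : open A -> Y `<=` A ->
  open [set p : pquot Y | if p is Some z then A (val z) else True].
Proof.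
move=> oA YA; rewrite /open /= /pquot_open (_ : _ @^-1` _ = A)//.
apply/seteqP; split=> z /=; have [Yz|/mem_set zY] := pselect (Y z).
- by move=> _; exact: YA.
- by rewrite (pquot_pi_notin zY).
- by rewrite pquot_pi_in.
- by rewrite (pquot_pi_notin zY).
Qed.

Lemma pquot_hausdorff : hausdorff_space Z -> compact Y -> hausdorff_space (pquot Y).
Proof.
move=> hZ cY; rewrite open_hausdorff.
have sep (z : ~` Y : set Z) : exists A B : set (pquot Y),
    [/\ open A, open B, A (Some z), B None & A `&` B = set0].
  have /set_mem zY := valP z.
  have [A [B [oA oB Az YB AB]]] := point_compact_separation hZ cY zY.
  have AY y : A y -> ~ Y y by move=> Ay /YB By; have : set0 y by rewrite -AB.
  exists [set p : pquot Y | if p is Some z then A (val z) else False].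
  exists [set p : pquot Y | if p is Some z then B (val z) else True].
  split=> //; [exact: pquot_open_some|exact: pquot_open_base|].
  apply/seteqP; split=> // -[u|] [] //= Au Bu.
  by have : set0 (val u) by rewrite -AB.
move=> [z|] [z'|] // zz'; last 2 first.
- have [A [B [oA oB Az Bn AB]]] := sep z; exists (A, B) => /=.
    by split; exact: mem_set.
  by split=> //; rewrite AB.
- have [A [B [oA oB Az Bn AB]]] := sep z'; exists (B, A) => /=.
    by split; exact: mem_set.
  by split=> //; rewrite setIC AB.
have vz : val z != val z' by apply: contra_neq zz' => /val_inj ->.
have oY : open (~` Y) by apply: closed_openC; exact: compact_closed.
move: hZ; rewrite open_hausdorff => /(_ _ _ vz)[[A B]/= [/set_mem Az /set_mem Bz']].
move=> [oA oB /eqP AB].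
exists ([set p : pquot Y | if p is Some z then (A `&` ~` Y) (val z) else False],
        [set p : pquot Y | if p is Some z then (B `&` ~` Y) (val z) else False]).
  by split; apply/mem_set; split=> //; [have /set_mem := valP z|have /set_mem := valP z'].
split.
- by apply: pquot_open_some => [|y []//]; exact: openI.
- by apply: pquot_open_some => [|y []//]; exact: openI.
- apply/eqP/seteqP; split=> // -[u|] [] //= [Au _] [Bu _].
  by have : set0 (val u) by rewrite -AB.
Qed.

Lemma pquot_compact : compact [set: Z] -> compact [set: pquot Y].
Proof.
(* The base point is added separately because the projection misses it when [Y] is empty. *)
move=> cZ; have -> : [set: pquot Y] = range (pquot_pi Y) `|` [set None].
  apply/seteqP; split=> // -[[z zY]|] _; last by right.
  by left; exists z => //; exact: pquot_pi_notin.
apply: compactU; last exact: compact_set1.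
apply: continuous_compact => //; apply: continuous_subspaceT.
exact: pquot_pi_continuous.
Qed.

End pointed_quotients.

Section pair_quotients.
Context (X : topologicalType) (N L : set X).

Lemma set_type_hausdorff : hausdorff_space X -> hausdorff_space N.
Proof.
by move=> hX; apply: (@hausdorff_inj N X val) => //; exact: val_continuous.
Qed.

Lemma set_type_compact (A : set X) : compact A -> A `<=` N ->
  compact ([set z | A (val z)] : set N).
Proof.
move=> cA AN; apply: ultra_compact => F UF FA.
have [p Ap Fp] := compact_ultra_cvg (ultra_fmap val UF) cA FA.
by exists (exist _ p (mem_set (AN p Ap))) => //; exact: set_type_cvg.
Qed.

Lemma pair_quot_hausdorff : hausdorff_space X -> compact L -> L `<=` N ->
  hausdorff_space (pair_quot N L).
Proof.
move=> hX cL LN; apply: pquot_hausdorff; first exact: set_type_hausdorff.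
exact: set_type_compact.
Qed.

Lemma pair_quot_compact : compact N -> compact [set: pair_quot N L].
Proof.
move=> cN; apply: pquot_compact.
rewrite (_ : [set: N] = [set z : N | N (val z)]); first exact: set_type_compact.
by apply/seteqP; split=> // z _ /=; have /set_mem := valP z.
Qed.

Lemma pair_class_lim (I : Type) (F : set_system I) {FF : Filter F} (v : I -> X)
    (x : X) : F [set i | N (v i)] -> N x -> v @ F --> x ->
  (fun i => pair_class N L (v i)) @ F --> pair_class N L x.
Proof.
move=> FN Nx vx G; rewrite nbhsE => -[H [oH Hx] HG].
move: oH; rewrite /open /= /pquot_open => -[D oD DH].
have DHE y (Ny : N y) : D y <-> H (pair_class N L y).
  rewrite -[y]/(val (exist _ y (mem_set Ny) : N)) pair_classE.
  by rewrite -[H _]/((pquot_pi _ @^-1` H) _) -DH.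
have FD : F [set i | D (v i)].
  by apply: vx; apply: open_nbhs_nbhs; split=> //; exact/DHE.
by apply: (@filterS2 _ F) FN FD => i /= Ni /(DHE _ Ni) /HG.
Qed.

Lemma pair_class_neq (x : X) : (N `\` L) x -> pair_class N L x <> point.
Proof.
move=> [Nx Lx]; rewrite -[x]/(val (exist _ x (mem_set Nx) : N)) pair_classE.
by rewrite (pquot_pi_notin (mem_set _)).
Qed.

Lemma pair_class_out (x : X) : pair_class N L x = point <-> ~ (N `\` L) x.
Proof. by split=> [h /pair_class_neq|]; [exact|exact: pair_class_base]. Qed.

Lemma pair_class_inj (x y : X) : (N `\` L) x -> (N `\` L) y ->
  pair_class N L x = pair_class N L y -> x = y.
Proof.
move=> [Nx Lx] [Ny Ly]; rewrite -[x]/(val (exist _ x (mem_set Nx) : N)).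
rewrite -[y]/(val (exist _ y (mem_set Ny) : N)) !pair_classE.
by move=> /pquot_piP[->|[]].
Qed.

Lemma pair_class_surj (p : pair_quot N L) : p <> point ->
  exists2 x, (N `\` L) x & pair_class N L x = p.
Proof.
case: p => [[z zL]|//] _; exists (val z); last by rewrite pair_classE pquot_pi_notin.
by split; [have /set_mem := valP z|exact: (set_mem zL)].
Qed.

End pair_quotients.

(** * The reduced mapping torus as a mapping torus with one circle collapsed *)

Section reduced_torus.
Context (R : realType) (P : ptopologicalType) (k : P -> P).
Hypotheses (k_continuous : continuous k) (k_point : k point = point).

Definition rclass (p : P) (s : I01 R) : rmtorus R k :=
  glue_pi (rtorus_rel R k) (half_class p s).

Lemma half_class_point s : half_class (point : P) s = point :> half_smash P (I01 R).
Proof. exact: pquot_pi_in. Qed.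

Lemma rclass_point s : rclass point s = point.
Proof. by rewrite /rclass half_class_point. Qed.

Lemma rclass_glue p : rclass p (oneI R) = rclass (k p) (zeroI R).
Proof. by apply/glue_piP; apply: Relation_Operators.rst_step; exists p. Qed.

(** Since k fixes the base point, the circle over it is invariant, and the reduced torus is
    [mtorus R k] with this circle collapsed. The semiflow descends along this map. *)
Definition torus_collapse (w : mtorus R k) : rmtorus R k :=
  rclass (repr w).1 (repr w).2.

Lemma torus_collapseE p s : torus_collapse (tclass k p s) = rclass p s.
Proof.
rewrite /torus_collapse; case E : (repr _) => [q r] /=.
have : tclass k q r = tclass k p s by rewrite -[RHS](glue_pi_repr) E.
move=> /tclass_eq h.
have rn z : rclass (torus_normal k z).1 (torus_normal k z).2 = rclass z.1 z.2.
  rewrite /torus_normal; case: eqP => //= z1; rewrite -rclass_glue.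
  by congr rclass; exact: I01_eq.
by rewrite -(rn (q, r)) h rn.
Qed.

Lemma torus_collapse_continuous : continuous torus_collapse.
Proof.
apply/quotient_continuous.
have -> : torus_collapse \o \pi_(mtorus R k)%qT =
    glue_pi (rtorus_rel R k) \o pquot_pi _.
  by apply/funext => -[p s] /=; rewrite -[RHS]/(rclass p s) -torus_collapseE.
move=> z; apply: continuous_comp; first exact: pquot_pi_continuous.
exact: glue_pi_continuous.
Qed.

Definition base_circle : set (mtorus R k) := [set w | exists s, w = tclass k point s].

Lemma base_circle_collapse w : base_circle w -> torus_collapse w = point.
Proof. by move=> [s ->]; rewrite torus_collapseE rclass_point. Qed.

Lemma base_circle_compact : compact base_circle.
Proof.
have -> : base_circle = (fun s => tclass k point s) @` [set: I01 R].
  by apply/seteqP; split=> [w [s ->]|w [s _ <-]]; exists s.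
apply: continuous_compact; last exact: I01_compact.
apply: continuous_subspaceT => s.
apply: (@tclass_lim R P k _ (nbhs s) _ (fun=> point) id point s).
  exact: cvg_cst.
exact: cvg_id.
Qed.

(** This leads to the inverse identification, from the reduced torus to the quotient of [mtorus R k]
    by the circle over the base point; it tells classes apart and pulls the Hausdorff property
    back. *)
Let embed_half (h : half_smash P (I01 R)) : pquot base_circle :=
  if h is Some z then pquot_pi _ (tclass k (val z).1 (val z).2) else None.

Let embed_halfE p s : embed_half (half_class p s) = pquot_pi _ (tclass k p s).
Proof.
rewrite /half_class; have [->|pN] := pselect (p = point).
  by rewrite pquot_pi_in// pquot_pi_in//; exists s.
by rewrite (@pquot_pi_notin _ [set z | z.1 = point] (p, s) (mem_set pN)).
Qed.

Let embed (w : rmtorus R k) : pquot base_circle := embed_half (repr w).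

Let embedE p s : embed (rclass p s) = pquot_pi _ (tclass k p s).
Proof.
rewrite /embed -embed_halfE.
have : gen_equiv (rtorus_rel R k) (repr (rclass p s)) (half_class p s).
  by apply/glue_piP; rewrite glue_pi_repr.
elim=> [_ _ [q [-> ->]]|//|a b _ ->//|a b c _ -> _ ->//].
by rewrite !embed_halfE tclass_glue.
Qed.

Lemma rclass_surj w : exists p s, val s < 1 /\ w = rclass p s.
Proof.
suff [p [s ->]] : exists p s, w = rclass p s.
  have [q [r [r1 h]]] := tclass_surj (tclass k p s); exists q, r; split=> //.
  by rewrite -!torus_collapseE h.
rewrite -(glue_pi_repr w); case: (repr w) => [[[p s] ps]|].
  by exists p, s; rewrite /rclass /half_class pquot_pi_notin.
by exists point, (zeroI R); rewrite rclass_point.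
Qed.

Lemma torus_collapse_surj w : exists w', torus_collapse w' = w.
Proof.
by have [p [s [_ ->]]] := rclass_surj w; exists (tclass k p s); rewrite torus_collapseE.
Qed.

Lemma torus_collapse_eq w w' : torus_collapse w = torus_collapse w' ->
  w = w' \/ (base_circle w /\ base_circle w').
Proof.
have [p [s [_ ->]]] := tclass_surj w; have [q [r [_ ->]]] := tclass_surj w'.
rewrite !torus_collapseE => /(congr1 embed); rewrite !embedE.
exact: pquot_piP.
Qed.

Lemma rclass_eq p s q r : val s < 1 -> val r < 1 -> rclass p s = rclass q r ->
  (p = q /\ s = r) \/ (p = point /\ q = point).
Proof.
move=> s1 r1; rewrite -!torus_collapseE => /torus_collapse_eq[|[]].
  by move=> /(tclass_inj s1 r1); left.
have base x y : val y < 1 -> base_circle (tclass k x y) -> x = point.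
  move=> y1 [t /tclass_eq]; rewrite torus_normal_id// /torus_normal /=.
  by case: eqP => _ [-> _].
by move=> /(base _ _ s1) -> /(base _ _ r1) ->; right.
Qed.

Lemma rclass_neq p s : val s < 1 -> p <> point -> rclass p s <> point.
Proof.
move=> s1 pN; have z1 : val (zeroI R) < 1 by exact: ltr01.
rewrite -(rclass_point (zeroI R)) => /(rclass_eq s1 z1).
by move=> [[]|[]].
Qed.

Lemma rclass_lim (I : Type) (F : set_system I) {FF : Filter F} (v : I -> P)
    (s : I -> I01 R) (p : P) (s0 : I01 R) : v @ F --> p -> s @ F --> s0 ->
  (fun i => rclass (v i) (s i)) @ F --> rclass p s0.
Proof.
move=> vp ss; rewrite -torus_collapseE.
under eq_fun do rewrite -torus_collapseE.
by apply: cvg_comp2 (@torus_collapse_continuous _); exact: tclass_lim.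
Qed.

Lemma rmtorus_hausdorff : hausdorff_space P -> hausdorff_space (rmtorus R k).
Proof.
move=> hP; apply: (@hausdorff_inj _ _ embed).
- apply/quotient_continuous.
  have -> : embed \o \pi_(rmtorus R k)%qT = embed_half.
    apply/funext => -[[[p s] ps]|] /=.
      have := embedE p s; rewrite -embed_halfE /rclass.
      by rewrite /half_class pquot_pi_notin.
    have := embedE point (zeroI R); rewrite -embed_halfE /rclass.
    by rewrite half_class_point.
  apply/continuousP => A oA; rewrite /open /= /pquot_open.
  rewrite (_ : _ @^-1` _ = (fun z => tclass k z.1 z.2) @^-1` (pquot_pi _ @^-1` A)).
    by apply: open_comp => // z _; exact: tclass_continuous.
  apply/seteqP; split => -[p s] /=.
    by rewrite -[pquot_pi _ _]/(half_class p s) embed_halfE.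
  by rewrite -[pquot_pi _ (p, s)]/(half_class p s) embed_halfE.
- move=> w w'.
  have [u <-] := torus_collapse_surj w; have [u' <-] := torus_collapse_surj w'.
  have [p [s [_ ->]]] := tclass_surj u; have [q [r [_ ->]]] := tclass_surj u'.
  rewrite !torus_collapseE !embedE => /pquot_piP[h|[h h']].
    by rewrite -!torus_collapseE h.
  by rewrite -!torus_collapseE !base_circle_collapse.
- apply: pquot_hausdorff; last exact: base_circle_compact.
  exact: mtorus_hausdorff.
Qed.

Lemma mtorus_compact : compact [set: P] -> compact [set: mtorus R k].
Proof.
move=> cP; have -> : [set: mtorus R k] =
    (fun z : P * I01 R => tclass k z.1 z.2) @` ([set: P] `*` [set: I01 R]).
  apply/seteqP; split=> // w _; have [p [s [_ ->]]] := tclass_surj w.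
  by exists (p, s).
apply: continuous_compact; last by apply: compact_setX => //; exact: I01_compact.
by apply: continuous_subspaceT; exact: tclass_continuous.
Qed.

Definition rtorus_flow (w : rmtorus R k) (t : R) : rmtorus R k :=
  torus_collapse (susp_flow R k (projT1 (cid (torus_collapse_surj w))) t).

Lemma base_circle_flow w t : 0 <= t -> base_circle w ->
  base_circle (susp_flow R k w t).
Proof.
move=> t0 [s ->]; rewrite susp_flowE//; exists (fracI (val s + t)).
congr tclass; elim: (`|_|%N) => //= n ->.
exact: k_point.
Qed.

Lemma rtorus_flowE w t : 0 <= t ->
  rtorus_flow (torus_collapse w) t = torus_collapse (susp_flow R k w t).
Proof.
move=> t0; rewrite /rtorus_flow; case: cid => w' /= /torus_collapse_eq[->//|].
by move=> [bw bw']; rewrite !base_circle_collapse//; exact: base_circle_flow.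
Qed.

Lemma rtorus_flow_point t : 0 <= t -> rtorus_flow point t = point.
Proof.
move=> t0; have b0 : base_circle (tclass k point (zeroI R)) by exists (zeroI R).
rewrite -{1}(base_circle_collapse b0) rtorus_flowE// base_circle_collapse//.
exact: base_circle_flow.
Qed.

(** Continuity is lifted to [mtorus R k]: arbitrary lifts converge along an ultrafilter since that
    space is compact, and the limit lies over the given point since the reduced torus is
    Hausdorff. *)
Lemma rtorus_semiflow : hausdorff_space P -> compact [set: P] -> semiflow rtorus_flow.
Proof.
move=> hP cP; have sP := susp_semiflow R k_continuous; split.
- apply: continuous_ultra => -[w t] F UF Fwt.
  have Fw := lim_fst Fwt; have Ft := lim_snd Fwt.
  pose sec (z : rmtorus R k * R) := projT1 (cid (torus_collapse_surj z.1)).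
  have secE z : torus_collapse (sec z) = z.1 by rewrite /sec; case: cid.
  have [w1 _ Fw1] := compact_ultra_cvg (ultra_fmap sec UF) (mtorus_compact cP) (@filterT _ F _).
  have <- : torus_collapse w1 = w.
    have h : (fun z => torus_collapse (sec z)) @ F --> torus_collapse w1.
      exact: (cvg_comp2 Fw1 (@torus_collapse_continuous w1)).
    apply: (hausdorff_lim (rmtorus_hausdorff hP) h).
    by under eq_fun do rewrite secE.
  have max_ge0 (r : R) : 0 <= Num.max 0 r by rewrite le_max lexx.
  rewrite /= rtorus_flowE//.
  have -> : (fun z : rmtorus R k * R => rtorus_flow z.1 (Num.max 0 z.2)) =
      fun z => torus_collapse (susp_flow R k (sec z) (Num.max 0 z.2)).
    by apply/funext => z; rewrite -{1}secE rtorus_flowE.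
  apply: cvg_comp2 (@torus_collapse_continuous _).
  apply: (semiflow_lim sP) => //.
  apply: (cvg_comp2 (g := fun r : R => Num.max 0 r) Ft).
  by apply: continuous_max; [exact: cst_continuous|exact: cvg_id].
- move=> w; have [u <-] := torus_collapse_surj w.
  by rewrite rtorus_flowE// (semiflow0 sP).
- move=> w s t s0 t0; have [u <-] := torus_collapse_surj w.
  by rewrite !rtorus_flowE ?addr_ge0// (semiflowD sP).
Qed.

End reduced_torus.

(** * The two models of the suspension semiflow *)

Section pair_quot_model.
Context (R : realType) (W : topologicalType) (phi : W -> R -> W) (S N L : set W).
Hypotheses (phiP : semiflow phi) (W_hausdorff : hausdorff_space W).
Hypothesis NLP : index_pair_flow S phi N L.

Let U := N `\` L.
Let cls := pair_class N L.

Let N_compact : compact N. Proof. by case: NLP => -[]. Qed.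
Let L_compact : compact L. Proof. by case: NLP => -[]. Qed.
Let LN : L `<=` N. Proof. by case: NLP => -[]. Qed.
Let N_closed : closed N. Proof. exact: compact_closed. Qed.
Let L_closed : closed L. Proof. exact: compact_closed. Qed.
Let UN : U `<=` N. Proof. by move=> x []. Qed.

Definition pair_flow (p : pair_quot N L) (t : R) : pair_quot N L :=
  if pselect (exists w, [/\ U w, cls w = p & orbit_in phi w t U]) is left h
  then cls (phi (projT1 (cid h)) t) else point.

Lemma pair_flow_in w t : 0 <= t -> orbit_in phi w t U ->
  pair_flow (cls w) t = cls (phi w t).
Proof.
move=> t0 wU; have Uw := orbit_in_start phiP t0 wU.
rewrite /pair_flow; case: pselect => [h|[]]; last by exists w.
by case: cid => /= w' [Uw' /(pair_class_inj Uw' Uw) ->].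
Qed.

Lemma pair_flow_out w t : 0 <= t -> ~ orbit_in phi w t U ->
  pair_flow (cls w) t = point.
Proof.
move=> t0 wU; rewrite /pair_flow; case: pselect => // -[w' [Uw' w'w w'U]].
exfalso; apply: wU; suff <- : w' = w by [].
have Uw : U w.
  by apply: contrapT => /pair_class_base h; apply: (pair_class_neq Uw'); rewrite -h.
exact: pair_class_inj w'w.
Qed.

Lemma pair_flow_point t : pair_flow point t = point.
Proof.
rewrite /pair_flow; case: pselect => // -[w [Uw w0]].
by have := pair_class_neq Uw.
Qed.

Lemma pair_quot_hausdorff_flow : hausdorff_space (pair_quot N L).
Proof. exact: pair_quot_hausdorff. Qed.

(** Representatives converge to some x in [N], possibly in [L]. If their orbits stay in [U], the
    limit orbit stays in [N] and, once in [L], remains there; if they leave [U], they meet [L] by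
    the exit condition, and so does the limit orbit. *)
Lemma pair_flow_continuous :
  continuous (fun z : pair_quot N L * R => pair_flow z.1 (Num.max 0 z.2)).
Proof.
apply: continuous_ultra => -[q t] F UF Fqt.
have Fq := lim_fst Fqt; have Ft := lim_snd Fqt.
have hQ := pair_quot_hausdorff_flow.
have [F0|FN] := in_ultra_setVsetC [set z : pair_quot N L * R | z.1 = point] UF.
  have q0 : q = point.
    apply: (hausdorff_lim hQ Fq); apply: (cvg_eq_on F0) (cvg_cst _) => z.
    by move=> /= ->.
  rewrite q0 /= pair_flow_point; apply: (cvg_eq_on F0) (cvg_cst _) => z /= ->.
  by rewrite pair_flow_point.
pose tau (z : pair_quot N L * R) := Num.max 0 z.2.
have tau0 z : 0 <= tau z by rewrite le_max lexx.
pose t' := Num.max 0 t; have t'0 : 0 <= t' by rewrite le_max lexx.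
have Ftau : tau @ F --> t'.
  apply: (cvg_comp2 (g := fun r : R => Num.max 0 r) Ft).
  by apply: continuous_max; [exact: cst_continuous|exact: cvg_id].
have [[q1 t1] /= q1N] := @filter_ex _ F _ _ FN.
have [w1 Uw1 _] := pair_class_surj q1N.
have /choice[v vP] (z : pair_quot N L * R) :
    exists w, z.1 <> point -> U w /\ cls w = z.1.
  have [z0|/pair_class_surj[w Uw wz]] := pselect (z.1 = point); first by exists w1.
  by exists w.
have FU : F [set z | U (v z) /\ cls (v z) = z.1].
  by apply: (@filterS _ F) FN => z /vP.
have FvN : F [set z | N (v z)] by apply: (@filterS _ F) FU => z [[]].
have [x Nx vx] := compact_ultra_cvg (ultra_fmap v UF) N_compact FvN.
have xq : cls x = q.
  have h : (fun z => cls (v z)) @ F --> cls x by exact: pair_class_lim.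
  apply: (hausdorff_lim hQ h); apply: (cvg_eq_on FU) Fq => z [_ ->]; by [].
pose G := [set z | orbit_in phi (v z) (tau z) U].
rewrite -[X in _ --> X]/(pair_flow q t') -xq.
have FflowE : F [set z | pair_flow z.1 (tau z) = pair_flow (cls (v z)) (tau z)].
  by apply: (@filterS _ F) FU => z [_ /= ->].
have [FG|FG] := in_ultra_setVsetC G UF.
  have yN : F [set z | N (phi (v z) (tau z))].
    by apply: (@filterS _ F) FG => z /(_ (tau z)); rewrite tau0 lexx => /(_ isT)[].
  have vy : (fun z => phi (v z) (tau z)) @ F --> phi x t' by exact: semiflow_lim.
  have Ny : N (phi x t').
    exact: (closed_lim (F := (fun z => phi (v z) (tau z)) @ F) N_closed yN vy).
  have lim : (fun z => pair_flow z.1 (tau z)) @ F --> cls (phi x t').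
    apply: (cvg_eq_on (filterI FflowE FG)) (pair_class_lim yN Ny vy) => z [/= -> zG].
    by rewrite pair_flow_in.
  suff -> : pair_flow (cls x) t' = cls (phi x t') by [].
  have [xU|xU] := pselect (orbit_in phi x t' U); first exact: pair_flow_in.
  rewrite pair_flow_out//; apply/esym/pair_class_base => -[_ yL].
  have xN s : 0 <= s <= t' -> N (phi x s).
    move=> /andP[s0]; rewrite le_eqVlt => /orP[/eqP -> //|st].
    apply: (closed_lim (F := (fun z => phi (v z) s) @ F) N_closed); last first.
      exact: semiflow_limc.
    have Fs : F [set z | s < tau z] by exact: (cvgr_gt _ Ftau).
    apply: (@filterS2 _ F) FG Fs => z zG sz; apply: UN; apply: zG.
    by rewrite s0 ltW.
  apply: xU => s /andP[s0 st]; split; first by apply: xN; rewrite s0.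
  (* Positive invariance of [L] relative to [N]: a visit to [L] at time s persists until time t'. *)
  move=> sL; apply: yL; have [_ [_ _ Lpos _]] := NLP.
  move: st; rewrite le_eqVlt => /orP[/eqP <- //|st].
  rewrite -(subrKC s t') (semiflowD phiP)//; last by rewrite subr_ge0 ltW.
  have ts0 : 0 < t' - s by rewrite subr_gt0.
  apply: (Lpos _ _ sL ts0); last by rewrite ltW//= lexx.
  move=> r /andP[r0 rt]; rewrite -(semiflowD phiP)//; apply: xN.
  by rewrite addr_ge0//= -lerBrDl.
have lim : (fun z => pair_flow z.1 (tau z)) @ F --> (point : pair_quot N L).
  apply: (cvg_eq_on (filterI FflowE FG)) (cvg_cst _) => z [/= -> zG].
  by rewrite pair_flow_out.
suff -> : pair_flow (cls x) t' = point by [].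
rewrite pair_flow_out// => xU.
(* A time in [L]: if the orbit is outside [U] at time s, then either it is in [N], hence in [L], or
   it has left [N] and the exit condition gives an earlier time. *)
have /choice[r rP] (z : pair_quot N L * R) : exists r, U (v z) -> ~ G z ->
    0 <= r <= tau z /\ L (phi (v z) r).
  have [Uz|] := pselect (U (v z)); last by exists 0.
  have [|Gz] := pselect (G z); first by exists 0.
  have [s /not_implyP[/andP[s0 st] sU]] : exists s, ~ (0 <= s <= tau z -> U (phi (v z) s)).
    by apply: contrapT => h; apply: Gz => s; apply: contrapT => hs; apply: h; exists s.
  have [sN|sN] := pselect (N (phi (v z) s)).
    exists s => _ _; split; first by rewrite s0.
    by apply: contrapT => sL; apply: sU.
  have [_ [_ _ _ exit]] := NLP.
  have s_gt0 : 0 < s.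
    rewrite lt_neqAle s0 andbT; apply/eqP => s00; apply: sN.
    by rewrite -s00 (semiflow0 phiP); exact: UN.
  have [r [/andP[r0 rs] rL _]] := exit _ _ (UN Uz) s_gt0 sN.
  by exists r => _ _; split=> //; rewrite r0 (le_trans rs).
have Fr : F [set z | 0 <= r z <= tau z /\ L (phi (v z) (r z))].
  by apply: (@filterS2 _ F) FU FG => z [Uz _] Gz; exact: rP.
have Ftau1 : F [set z | tau z < t' + 1] by apply: (cvgr_lt _ Ftau); rewrite ltrDl.
have [|r0 _ rr0] := compact_ultra_cvg (ultra_fmap r UF) (@segment_compact R 0 (t' + 1)).
  apply: (@filterS2 _ F) Fr Ftau1 => z [/andP[r0 rt] _] zt.
  by rewrite /preimage /= in_itv/= r0 ltW// (le_lt_trans rt).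
have r00 : 0 <= r0.
  apply: (closed_lim (A := [set u : R | 0 <= u]) (F := r @ F)) rr0.
    exact: closed_ge.
  by apply: (@filterS _ F) Fr => z [/andP[]].
have r0t : r0 <= t'.
  rewrite -subr_ge0.
  apply: (closed_lim (A := [set u : R | 0 <= u]) (F := (fun z => tau z - r z) @ F)).
  - exact: closed_ge.
  - by apply: (@filterS _ F) Fr => z [/andP[_ ?] _]; rewrite /preimage/= subr_ge0.
  - exact: cvgB.
have L0 : L (phi x r0).
  (* [semiflow_lim] needs nonnegative times for every index, whereas [r] is controlled only for
     almost all. *)
  pose r' z := Num.max 0 (r z).
  apply: (closed_lim (F := (fun z => phi (v z) (r' z)) @ F) L_closed).
    apply: (@filterS _ F) Fr => z [/andP[rz _] Lz].
    by rewrite /preimage /= /r' max_r.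
  apply: semiflow_lim => //; last by move=> z; rewrite le_max lexx.
  apply: (cvg_eq_on Fr) rr0 => z [/andP[rz _] _].
  by rewrite /r' max_r.
by have [] := xU r0; rewrite ?r00.
Qed.

Lemma pair_flow_semiflow : semiflow pair_flow.
Proof.
split; first exact: pair_flow_continuous.
  move=> p; have [->|/pair_class_surj[w Uw <-]] := pselect (p = point).
    exact: pair_flow_point.
  rewrite pair_flow_in ?(semiflow0 phiP)// => s /andP[s0 s1].
  by rewrite (_ : s = 0) ?(semiflow0 phiP)//; apply/eqP; rewrite eq_le s0 s1.
move=> p s t s0 t0; have [->|/pair_class_surj[w Uw <-]] := pselect (p = point).
  by rewrite !pair_flow_point.
have st0 := addr_ge0 s0 t0.
have [wU|wU] := pselect (orbit_in phi w s U); last first.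
  rewrite (pair_flow_out s0 wU) pair_flow_point pair_flow_out// => h; apply: wU.
  by apply: (orbit_in_le _ h); rewrite lerDl.
rewrite (pair_flow_in s0 wU); have [w'U|w'U] := pselect (orbit_in phi (phi w s) t U).
  rewrite (pair_flow_in t0 w'U) pair_flow_in ?(semiflowD phiP)//.
  exact: orbit_inD.
rewrite (pair_flow_out t0 w'U) pair_flow_out// => h; apply: w'U.
exact: (orbit_in_shift phiP s0 (lexx _) h).
Qed.

(** The hull is the closure of [N] \ [L], whose invariant part is [S], and the core is its interior,
    which absorbs because it is open and contains [S]. Convergence of classes gives convergence in
    [W] by compactness of [N]. *)
Lemma pair_quot_flow_model : flow_model phi S (pair_quot N L).
Proof.
have [_ [NLinv SU _ _]] := NLP.
have clU : closure U `<=` N.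
  by rewrite [X in _ `<=` X](closure_id N).1//; exact: closure_subset.
apply: (@FlowModel _ _ _ _ _ U (interior U) (closure U) cls pair_flow).
- exact: pair_quot_hausdorff_flow.
- exact: interior_subset.
- exact: subset_closure.
- exact: subclosed_compact (@closed_closure _ _) N_compact clU.
- by rewrite NLinv.
- by move=> w; exact: pair_class_out.
- by move=> w w'; exact: pair_class_inj.
- by move=> p; exact: pair_class_surj.
- exact: pair_flow_semiflow.
- by move=> t _; exact: pair_flow_point.
- exact: pair_flow_in.
- exact: pair_flow_out.
- move=> F w UF FU Uw Fw; apply: pair_class_lim => //.
    by apply: (@filterS _ F) FU => w' /interior_subset[].
  by have [] := interior_subset Uw.
- move=> F w UF FU Uw Fw; have FN : F N by apply: (@filterS _ F) FU => w' [].
  have [x Nx Fx] := compact_ultra_cvg UF N_compact FN.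
  suff -> : w = x by [].
  have xw : cls x = cls w.
    apply: (hausdorff_lim pair_quot_hausdorff_flow _ Fw).
    exact: (pair_class_lim (v := id)).
  have {}Uw := interior_subset Uw.
  apply: (pair_class_inj Uw _ (esym xw)); apply: contrapT => /pair_class_base x0.
  exact: (pair_class_neq Uw (etrans (esym xw) x0)).
- move=> M cM MS; have [|n nM] := flow_core_absorb phiP W_hausdorff cM (@open_interior _ U).
    exact: subset_trans MS SU.
  by exists n%:R => //; exact: ler0n.
Qed.

End pair_quot_model.

(** * Invariant sets of a map and of its suspension semiflow *)

Section suspension_invariance.
Context (R : realType) (X : topologicalType) (f : X -> X).
Hypothesis f_continuous : continuous f.
Local Notation phi := (susp_flow R f).

Lemma inv_map_orbit (M : set X) x : inv_map M f x ->
  exists g : int -> X, [/\ g 0 = x, forall n, inv_map M f (g n) &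
    forall n, g (n + 1) = f (g n)].
Proof.
move=> [g [g0 gM gS]]; exists g; split=> // n.
exists (fun m => g (n + m)); split=> [|m|m]; first by rewrite addr0.
  exact: gM.
by rewrite addrA gS.
Qed.

Lemma inv_map_image (M : set X) x : inv_map M f x -> inv_map M f (f x).
Proof.
by move=> /inv_map_orbit[g [<- gM gS]]; rewrite -gS.
Qed.

Lemma inv_map_preimage (M : set X) x : inv_map M f x ->
  exists2 y, inv_map M f y & f y = x.
Proof.
move=> /inv_map_orbit[g [<- gM gS]]; exists (g (-1)) => //.
by rewrite -gS addNr.
Qed.

Lemma inv_map_mono (A B : set X) : A `<=` B -> inv_map A f `<=` inv_map B f.
Proof. by move=> AB x [g [g0 gA gS]]; exists g; split=> // n; exact/AB/gA. Qed.

Lemma inv_map_self (S : set X) : (forall x, S x -> S (f x)) ->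
  (forall x, S x -> exists2 y, S y & f y = x) -> S `<=` inv_map S f.
Proof.
move=> Sf Spre x Sx.
have /choice[prev prevP] y : exists z, S y -> S z /\ f z = y.
  have [/Spre[z Sz zy]|nS] := pselect (S y); first by exists z.
  by exists y.
have Sit n : S (iter n prev x) by elim: n => //= n /prevP[].
have Sitf n : S (iter n f x) by elim: n => //= n /Sf.
exists (fun n : int => if n is Posz m then iter m f x
  else iter `|n|%N prev x); split=> //.
  by case=> [m|m]; [exact: Sitf|exact: Sit].
case=> [m|[|m]].
- by rewrite (_ : Posz m + 1 = Posz m.+1)//; lia.
- by rewrite (_ : Negz 0 + 1 = 0)//=; have [_ ->] := prevP _ Sx.
- rewrite (_ : Negz m.+1 + 1 = Negz m) /=; last by rewrite !NegzE; lia.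
  by have [_ ->] := prevP _ (Sit m.+1).
Qed.

Lemma suspension_compact (A : set X) : compact A -> compact (suspension R f A).
Proof.
move=> cA; have -> : suspension R f A =
    (fun z : X * I01 R => tclass f z.1 z.2) @` (A `*` [set: I01 R]).
  apply/seteqP; split=> [w [x [s [Ax ->]]]|w [[x s] [Ax _] <-]]; last by exists x, s.
  by exists (x, s).
apply: continuous_compact; last by apply: compact_setX => //; exact: I01_compact.
by apply: continuous_subspaceT; exact: tclass_continuous.
Qed.

Lemma suspension_inv_flow (M : set X) :
  suspension R f (inv_map M f) `<=` inv_flow (suspension R f (inv_map M f)) phi.
Proof.
move=> w Sw; apply: (full_solution_of_steps (susp_semiflow R f_continuous) Sw).
  move=> _ [x [s [/inv_map_preimage[y My <-] ->]]].
  exists (tclass f y s); first by exists y, s.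
  have /andP[s0 _] := I01_bounds s.
  rewrite susp_flow_orbit// -[1]/(1%:R) -torus_orbit_shift//.
  exact: torus_orbit_frac.
move=> _ t [x [s [Mx ->]]] t0; rewrite susp_flowE//.
exists (iter `|Num.floor (val s + t)|%N f x), (fracI (val s + t)); split=> //.
by elim: (`|_|%N) => //= n; exact: inv_map_image.
Qed.

(** A full solution through [x, s] is at height 0 at the times n - s, and its points there form a
    full solution of f. Looking at one height q in each turn suffices to see that this solution lies
    in [A]. *)
Lemma inv_flow_suspension (M' : set (mtorus R f)) (A : set X) (q : I01 R) :
  (forall x, M' (tclass f x q) -> A x) -> val q < 1 ->
  inv_flow M' phi `<=` suspension R f (inv_map A f).
Proof.
move=> M'A q1 w [g [g0 gM' gS]].
have [x [s [s1 wx]]] := tclass_surj w; have /andP[s0 _] := I01_bounds s.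
have /andP[q0 _] := I01_bounds q.
(* If the height at time -m - s is r, flowing for time m + s leads to height s; so r is an integer
   in [0, 1). *)
have gneg (m : nat) : exists a, g (- m%:R - val s) = tclass f a (zeroI R).
  have [a [r [r1 ar]]] := tclass_surj (g (- m%:R - val s)); exists a.
  have ms0 : 0 <= m%:R + val s by rewrite addr_ge0.
  have := gS (- m%:R - val s) (m%:R + val s) ms0.
  rewrite (_ : - m%:R - val s + _ = 0); last by rewrite -opprD addNr.
  have /andP[r0 _] := I01_bounds r.
  rewrite g0 ar wx susp_flow_orbit//.
  have [n [r' [-> rr' r'1]]] := torus_orbit_tclass f a (addr_ge0 r0 ms0).
  move=> /(tclass_inj s1 r'1)[_ sr']; subst r'.
  suff r_0 : r = zeroI R by rewrite r_0.
  apply: I01_eq => /=; have {}rr' : val r = n%:R - m%:R by lra.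
  case: (ltngtP n m) => nm.
  - have := nm; rewrite -(ltr_nat R) -subr_lt0 -rr' => r00.
    by have := le_lt_trans r0 r00; rewrite ltxx.
  - have := nm; rewrite -(ler_nat R) -natr1 -lerBrDl -rr' => r10.
    by have := le_lt_trans r10 r1; rewrite ltxx.
  - by move: rr'; rewrite nm subrr.
(* The time n - s is reached by flowing forward from -|n| - s, since n + |n| >= 0. *)
have gint (n : int) : exists a, g (n%:~R - val s) = tclass f a (zeroI R).
  have [a ha] := gneg `|n|%N.
  have nn : 0 <= n + `|n|%N%:Z by lia.
  have nnR : 0 <= (n%:~R : R) + `|n|%N%:R.
    by rewrite -[`|n|%N%:R]/(`|n|%N%:Z%:~R) -intrD ler0z.
  have := gS (- `|n|%N%:R - val s) (n%:~R + `|n|%N%:R) nnR.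
  rewrite (_ : - `|n|%N%:R - val s + _ = n%:~R - val s); last by lra.
  move=> ->; rewrite ha susp_flow_orbit//= add0r.
  exists (iter (absz (n + (absz n)%:Z)) f a).
  rewrite -(torus_orbit_frac f _ (zeroI R)) torus_orbit_shift// add0r.
  congr torus_orbit; rewrite -[RHS]/((absz (n + (absz n)%:Z))%:Z%:~R).
  by rewrite gez0_abs// intrD.
have [a aP] := choice gint.
exists x, s; split=> //; exists a; split.
- have := gS (- val s) (val s) s0; rewrite addNr g0 wx.
  have := aP 0; rewrite sub0r => ->; rewrite susp_flow_orbit//= add0r torus_orbit_frac.
  by move=> /(tclass_inj s1 s1)[].
- move=> n; apply: M'A; have := gS (n%:~R - val s) (val q) q0.
  by rewrite aP susp_flow_orbit//= add0r torus_orbit_frac => <-.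
- move=> n; have := gS (n%:~R - val s) 1 ler01; rewrite aP susp_flow_orbit//=.
  have -> : torus_orbit f (a n) (0 + 1) = tclass f (f (a n)) (zeroI R).
    rewrite -(torus_orbit_frac f (f (a n)) (zeroI R)).
    exact: esym (@torus_orbit_shift R X f (a n) 0 1%N (lexx 0)).
  rewrite addrAC -[X in _ + X - _]/(1%:~R) -intrD aP => h.
  have z1 : val (zeroI R) < 1 by exact: ltr01.
  by have [] := tclass_inj z1 z1 h.
Qed.

End suspension_invariance.

(** * The reduced mapping torus of an index pair as a model of the suspension semiflow *)

Section rmtorus_model.
Context (R : realType) (X : topologicalType) (f : X -> X) (S N L : set X).
Hypotheses (f_continuous : continuous f) (X_hausdorff : hausdorff_space X).
Hypothesis NLP : index_pair_map S f N L.
Local Notation phi := (susp_flow R f).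

Let V := N `\` L.
Let kappa := pair_map f N L.
Let pc := pair_class N L.

Let N_compact : compact N. Proof. by case: NLP => -[]. Qed.
Let L_compact : compact L. Proof. by case: NLP => -[]. Qed.
Let LN : L `<=` N. Proof. by case: NLP => -[]. Qed.
Let kappa_continuous : continuous kappa. Proof. by case: NLP => _ []. Qed.
Let kappa_point : kappa point = point. Proof. by []. Qed.
Let P_hausdorff : hausdorff_space (pair_quot N L).
Proof. exact: pair_quot_hausdorff. Qed.
Let P_compact : compact [set: pair_quot N L].
Proof. exact: pair_quot_compact. Qed.
Let W_hausdorff := mtorus_hausdorff (R := R) f_continuous X_hausdorff.
Let phiP := susp_semiflow R f_continuous.

Definition torus_coord (w : mtorus R f) : X * I01 R := torus_normal f (repr w).

Lemma torus_coordE x s : val s < 1 -> torus_coord (tclass f x s) = (x, s).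
Proof.
move=> s1; rewrite /torus_coord; case E : (repr _) => [y r].
have : tclass f y r = tclass f x s by rewrite -[RHS](glue_pi_repr) E.
by move=> /tclass_eq ->; exact: torus_normal_id.
Qed.

Lemma torus_coordP w : val (torus_coord w).2 < 1 /\
  w = tclass f (torus_coord w).1 (torus_coord w).2.
Proof.
have [x [s [s1 ->]]] := tclass_surj w; by rewrite torus_coordE.
Qed.

Let dom (A : set X) : set (mtorus R f) := [set w | A (torus_coord w).1].
Let cls (w : mtorus R f) : rmtorus R kappa := rclass kappa (pc (torus_coord w).1) (torus_coord w).2.

Lemma domE A x s : val s < 1 -> dom A (tclass f x s) = A x.
Proof. by move=> s1; rewrite /dom /= torus_coordE. Qed.

Lemma clsE x s : val s < 1 -> cls (tclass f x s) = rclass kappa (pc x) s.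
Proof. by move=> s1; rewrite /cls torus_coordE. Qed.

Lemma pair_map_iter_in x n : (forall j, (j <= n)%N -> V (iter j f x)) ->
  iter n kappa (pc x) = pc (iter n f x).
Proof.
elim: n => //= n IH h; rewrite IH; last by move=> j jn; apply: h; exact: leqW.
by apply: pair_map_in; [exact: (h n)|exact: (h n.+1)].
Qed.

Lemma pair_map_iter_out x n j : (j <= n)%N -> ~ V (iter j f x) ->
  iter n kappa (pc x) = point.
Proof.
elim: n j => [|n IH] j; first by rewrite leqn0 => /eqP ->; exact: pair_class_base.
rewrite leq_eqVlt => /orP[/eqP -> xj|]; last by rewrite ltnS => jn /(IH _ jn) /= ->.
have [h|/existsNP[i /not_implyP[ij hi]]] :=
    pselect (forall i, (i <= n)%N -> V (iter i f x)).
  by rewrite /= pair_map_iter_in//; apply: pair_map_out => -[].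
by rewrite /= (IH _ ij hi).
Qed.

(** The orbit runs exactly over x, f x, ..., f^n x, and it enters the turn over f^j x at time j - s.
    This reduces continuous time to iterates. *)
Lemma orbit_in_dom A x (s : I01 R) t n (s' : I01 R) : val s < 1 -> 0 <= t ->
  val s + t = n%:R + val s' -> val s' < 1 ->
  orbit_in phi (tclass f x s) t (dom A) <-> forall j, (j <= n)%N -> A (iter j f x).
Proof.
move=> s1 t0 st s'1; have /andP[s0 _] := I01_bounds s.
have /andP[s'0 _] := I01_bounds s'.
split=> [xA [|j] jn|xA r /andP[r0 rt]].
- have := xA 0; rewrite lexx t0 susp_flow_orbit// addr0 torus_orbit_frac domE//.
  exact.
- have jnR : (j.+1%:R : R) <= n%:R by rewrite ler_nat.
  have js : 0 <= j.+1%:R - val s.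
    by rewrite subr_ge0 ltW// (lt_le_trans s1)// ler1n.
  have jt : j.+1%:R - val s <= t.
    by rewrite lerBlDl st; apply: (le_trans jnR); rewrite lerDl.
  have := xA (j.+1%:R - val s); rewrite js jt susp_flow_orbit// subrKC.
  rewrite -[j.+1%:R]add0r -torus_orbit_shift// -[0]/(val (zeroI R)) torus_orbit_frac.
  by rewrite domE//=; apply.
- rewrite susp_flow_orbit//.
  have [m [r' [-> mr r'1]]] := torus_orbit_tclass f x (addr_ge0 s0 r0).
  have /andP[r'0 _] := I01_bounds r'.
  rewrite domE//; apply: xA; rewrite -ltnS -(ltr_nat R) -natr1.
  have : m%:R + val r' <= n%:R + val s' by rewrite -mr -st lerD2l.
  lra.
Qed.

Lemma cls_flow w t : 0 <= t -> exists n x s,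
  [/\ cls w = rclass kappa (pc x) (torus_coord w).2,
      rtorus_flow (cls w) t = rclass kappa (iter n kappa (pc x)) s,
      phi w t = tclass f (iter n f x) s, val s < 1 &
      forall A, orbit_in phi w t (dom A) <-> forall j, (j <= n)%N -> A (iter j f x)].
Proof.
move=> t0; have [x [s [s1 ->]]] := tclass_surj w; have /andP[s0 _] := I01_bounds s.
have [n nst] := nat_floor (addr_ge0 s0 t0); have /andP[n1 n2] := nst.
have {}nst : n%:R <= val s + t <= n.+1%:R by rewrite n1 ltW.
pose s' := clampI (val s + t - n%:R).
have s'E : val s' = val s + t - n%:R.
  by rewrite clampI_val// subr_ge0 n1 lerBlDl natr1 ltW.
have s'1 : val s' < 1 by rewrite s'E ltrBlDl natr1.
exists n, x, s'; split=> //.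
- by rewrite torus_coordE// clsE.
- rewrite clsE// -torus_collapseE rtorus_flowE// susp_flow_orbit//.
  by rewrite (torus_orbit_piece _ _ nst) torus_collapseE.
- by rewrite susp_flow_orbit// (torus_orbit_piece _ _ nst).
- by move=> A; apply: (@orbit_in_dom A x s t n s') => //; rewrite s'E subrKC.
Qed.

(** Heights below 1 may tend to s = 1, and then (y, s) is not the normal form of the limit. This is
    the case that the next two lemmas have to treat. *)
Lemma coord_lim (F : set_system (mtorus R f)) : UltraFilter F -> F (dom V) ->
  exists y s, [/\ N y, (fun w => (torus_coord w).1) @ F --> y,
    (fun w => (torus_coord w).2) @ F --> s, F --> tclass f y s &
    cls @ F --> rclass kappa (pc y) s].
Proof.
move=> UF FV.
have FN : F [set w | N (torus_coord w).1] by apply: (@filterS _ F) FV => w [].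
have [y Ny vy] := compact_ultra_cvg (ultra_fmap (fun w => (torus_coord w).1) UF) N_compact FN.
have [s _ ss] := compact_ultra_cvg (ultra_fmap (fun w => (torus_coord w).2) UF)
  (@I01_compact R) (@filterT _ F _).
exists y, s; split=> //.
  have h : (fun w => tclass f (torus_coord w).1 (torus_coord w).2) @ F --> tclass f y s.
    exact: tclass_lim.
  move: h; rewrite (_ : (fun w => _) = id)//; apply/funext => w.
  by have [_ <-] := torus_coordP w.
by apply: rclass_lim => //; exact: pair_class_lim.
Qed.

(** If the heights tend to 1, the limit is [f y, 0] and [kappa (pc y) = pc (f y)] is required,
    although y is only known to lie in [N]. Nearby base coordinates and their images are in [V],
    where the identity holds, and it passes to the limit by continuity of [kappa]. *)
Lemma rmtorus_class_cvg (F : set_system (mtorus R f)) w : UltraFilter F ->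
  F (dom (interior V)) -> dom (interior V) w -> F --> w -> cls @ F --> cls w.
Proof.
move=> UF FV Vw Fw.
have FV' : F (dom V) by apply: (@filterS _ F) FV => w' /interior_subset.
have [y [s [Ny vy _ Fys clsF]]] := coord_lim UF FV'.
have wE : w = tclass f y s by exact: (hausdorff_lim W_hausdorff Fw Fys).
suff -> : cls w = rclass kappa (pc y) s by [].
have [s1|s1] := ltP (val s) 1; first by rewrite wE clsE.
have {}s1 : s = oneI R.
  by apply: I01_eq; apply/eqP; rewrite eq_le s1 andbT; case/andP: (I01_bounds s).
have z1 : val (zeroI R) < 1 by exact: ltr01.
rewrite s1 tclass_glue in wE; rewrite s1 rclass_glue wE clsE//; congr rclass.
rewrite wE domE// in Vw.
pose v w' := (torus_coord w').1.
have fv : (fun w' => f (v w')) @ F --> f y.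
  by apply: (cvg_comp2 vy); exact: f_continuous.
have FfV : F [set w' | V (f (v w'))].
  have : F [set w' | interior V (f (v w'))].
    by apply: fv; apply: open_nbhs_nbhs; split=> //; exact: open_interior.
  by apply: (@filterS _ F) => w' /interior_subset.
have FfN : F [set w' | N (f (v w'))] by apply: (@filterS _ F) FfV => w' [].
have lim1 : (fun w' => pc (f (v w'))) @ F --> pc (f y).
  by apply: pair_class_lim => //; have [] := interior_subset Vw.
apply: (hausdorff_lim P_hausdorff lim1).
have FN : F [set w' | N (v w')] by apply: (@filterS _ F) FV' => w' [].
have lim2 : (fun w' => kappa (pc (v w'))) @ F --> kappa (pc y).
  apply: (cvg_comp2 (f := fun w' => pc (v w'))); last exact: kappa_continuous.
  exact: pair_class_lim.
apply: (cvg_eq_on (filterI FV' FfV)) lim2 => w' [Vw' Vfw'].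
exact: pair_map_in.
Qed.

(** If the heights tend to 1, the limit class is that of [kappa (pc y)] at height 0. It is not the
    base point, which forces both y and f y into [V]. *)
Lemma rmtorus_cvg_class (F : set_system (mtorus R f)) w : UltraFilter F ->
  F (dom V) -> dom (interior V) w -> cls @ F --> cls w -> F --> w.
Proof.
move=> UF FV Vw clsw.
have [y [s [Ny _ _ Fys clsF]]] := coord_lim UF FV.
suff -> : w = tclass f y s by [].
have clsE' : rclass kappa (pc y) s = cls w.
  exact: (hausdorff_lim (rmtorus_hausdorff kappa_continuous P_hausdorff) clsF).
have {}Vw := interior_subset Vw; have [w1 wE] := torus_coordP w.
have pN : pc (torus_coord w).1 <> point by exact: pair_class_neq.
have pcV x : pc x <> point -> V x by move=> h; apply: contrapT => /pair_class_base.
have [s1|s1] := ltP (val s) 1.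
  have [[h h']|[_ //]] := rclass_eq kappa_point s1 w1 clsE'.
  rewrite [LHS]wE h'; congr tclass; apply: (pair_class_inj Vw _ (esym h)).
  by apply: pcV; rewrite h.
have {}s1 : s = oneI R.
  by apply: I01_eq; apply/eqP; rewrite eq_le s1 andbT; case/andP: (I01_bounds s).
have z1 : val (zeroI R) < 1 by exact: ltr01.
rewrite s1 rclass_glue in clsE'; rewrite s1 tclass_glue [LHS]wE.
have [[h h']|[_ //]] := rclass_eq kappa_point z1 w1 clsE'.
have [Vy Vfy] : V y /\ V (f y).
  by apply: contrapT => hy; apply: pN; rewrite -h; exact: pair_map_out hy.
rewrite -h'; congr tclass; apply: (pair_class_inj Vw Vfy); rewrite -[LHS]h.
exact: pair_map_in.
Qed.

(** The core is not open in the torus, so it is not absorbed directly. The set [G] of all (x, s)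
    with x in the interior of [V] and s < 1, or f x there and s > 0, is saturated and open, contains
    the suspension of S, and means at height 0 that x is in the interior of [V]. *)
Lemma rmtorus_absorb (M : set (mtorus R f)) : compact M ->
  inv_flow M phi `<=` suspension R f S ->
  exists2 T, 0 <= T & flow_core phi M T `<=` dom (interior V).
Proof.
move=> cM MS; have [_ [_ SV _]] := NLP.
have oV : open (interior V) by exact: open_interior.
pose G := [set z : X * I01 R | interior V z.1 /\ val z.2 < 1] `|`
          [set z : X * I01 R | interior V (f z.1) /\ 0 < val z.2].
have oG : open G.
  have o1 (B : set X) : open B -> open [set z : X * I01 R | B z.1].
    by move=> oB; apply: (@open_comp _ _ fst) => // z _; exact: cvg_fst.
  have o2 (B : set R) : open B -> open [set z : X * I01 R | B (val z.2)].
    move=> oB; apply: (@open_comp _ _ snd [set r : I01 R | B (val r)]).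
      by move=> z _; exact: cvg_snd.
    exact: open_val_lt.
  have lt1 : open [set r : R | r < 1] by exact: open_lt.
  have gt0 : open [set r : R | 0 < r] by exact: open_gt.
  apply: openU; apply: openI.
  - exact: o1.
  - exact: (o2 _ lt1).
  - by apply: (o1 (f @^-1` interior V)); apply: open_comp => // x _; exact: f_continuous.
  - exact: (o2 _ gt0).
have [x|H oH HG] := @open_torus_saturated R X f G oG.
  by split=> -[[/= h1 h2]|[/= h1 h2]]; [lra|left|right|lra]; split=> //; exact: ltr01.
have SH : inv_flow M phi `<=` H.
  move=> w /MS[x [s [Sx ->]]]; apply/HG.
  have [s1|s1] := ltP (val s) 1; first by left; split=> //; exact: SV.
  right; split; last by apply: lt_le_trans s1.
  by have [_ [Sinv _ _]] := NLP; apply: SV; move: Sx; rewrite -Sinv; exact: inv_map_image.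
have [n nH] := flow_core_absorb phiP W_hausdorff cM oH SH.
(* One extra unit of time allows going back from height s to height 0 of the same turn, by less than
   1, while remaining in the core for n. *)
exists (n%:R + 1); first by rewrite addr_ge0// ler0n.
move=> _ [w wM <-]; have [a [r [r1 wE]]] := tclass_surj w; subst w.
have n0 : 0 <= (n%:R : R) by [].
have nn : 0 <= (n%:R + 1 : R) by rewrite addr_ge0.
have /andP[r0 _] := I01_bounds r.
have [m [s [h1 h2 s1]]] := torus_orbit_tclass f a (addr_ge0 r0 nn).
have /andP[s0 _] := I01_bounds s.
rewrite susp_flow_orbit// h1 domE//.
have : H (phi (tclass f a r) (n%:R + 1 - val s)).
  apply: nH; apply: (flow_core_anti phiP (s := n%:R) (t := n%:R + 1 - val s)).
    by rewrite n0 /= lerBrDr lerD2l ltW.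
  apply: flow_core_orbit; apply: (orbit_in_le _ wM).
  by apply: lerD; rewrite gerBl.
rewrite susp_flow_orbit; last by rewrite subr_ge0 (le_trans (ltW s1))// lerDr.
rewrite addrA h2 addrK -[m%:R]add0r -torus_orbit_shift// -[0]/(val (zeroI R)) torus_orbit_frac.
by move=> /HG[[]//|[_]]; rewrite /= ltxx.
Qed.

Lemma rmtorus_flow_model : flow_model phi (suspension R f S) (rmtorus R kappa).
Proof.
have [_ [Sinv SV _]] := NLP.
have V0 (w : mtorus R f) : dom V w -> pc (torus_coord w).1 <> point.
  exact: pair_class_neq.
have clV : closure V `<=` N.
  have N_closed : closed N by exact: compact_closed.
  by rewrite [X in _ `<=` X](closure_id N).1//; apply: closure_subset => x [].
apply: (@FlowModel _ _ _ _ _ (dom V) (dom (interior V))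
  (suspension R f (closure V)) cls (@rtorus_flow R _ kappa)).
- exact: rmtorus_hausdorff.
- by move=> w; exact: interior_subset.
- move=> w Vw; have [_ ->] := torus_coordP w.
  by exists (torus_coord w).1, (torus_coord w).2; split=> //; exact: subset_closure.
- apply: suspension_compact => //.
  exact: subclosed_compact (@closed_closure _ _) N_compact clV.
(* At a height strictly between 0 and 1 a class has only one representative, so membership in the
   suspension determines the base coordinate. *)
- have half_bounds : 0 <= (1 / 2 : R) <= 1 by apply/andP; split; lra.
  rewrite -Sinv; apply: (inv_flow_suspension (q := mkI half_bounds)).
    move=> x [y [s [Vy /tclass_eq]]]; rewrite torus_normal_id /=; last by lra.
    rewrite /torus_normal /=; case: eqP => _ [-> //] h.
    by exfalso; move: h; lra.
  by rewrite /=; lra.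
- move=> w; rewrite -pair_class_out; have [s1 _] := torus_coordP w.
  split=> [h|h]; last by rewrite /cls /pc h rclass_point.
  by apply: contrapT => /(rclass_neq kappa_point s1); apply.
- move=> w w' Vw Vw'; have [s1 wE] := torus_coordP w; have [s1' wE'] := torus_coordP w'.
  move=> /(rclass_eq kappa_point s1 s1')[[h h']|[h _]]; last first.
    by have := V0 _ Vw.
  by rewrite wE wE' h' (pair_class_inj Vw Vw' h).
- move=> p pN; have [q [s [s1 pE]]] := rclass_surj p; subst p.
  have qN : q <> point by move=> q0; apply: pN; rewrite q0 rclass_point.
  have [x Vx xq] := pair_class_surj qN.
  by exists (tclass f x s); rewrite ?domE// clsE// /pc xq.
- exact: rtorus_semiflow.
- by move=> t t0; exact: rtorus_flow_point.
- move=> w t t0 wV; have [n [x [s [_ -> -> s1 /(_ V)[/(_ wV) h _]]]]] := cls_flow w t0.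
  by rewrite clsE// pair_map_iter_in.
- move=> w t t0 wV; have [n [x [s [_ -> _ s1 /(_ V)[_ h]]]]] := cls_flow w t0.
  have [hV|/existsNP[i /not_implyP[ij hi]]] :=
    pselect (forall i, (i <= n)%N -> V (iter i f x)); first by have := wV (h hV).
  by rewrite (pair_map_iter_out ij hi) rclass_point.
- exact: rmtorus_class_cvg.
- exact: rmtorus_cvg_class.
- exact: rmtorus_absorb.
Qed.

End rmtorus_model.

(** * Index pairs of maps *)

Section compact_neighbourhoods.
Context (R : realType) (X : metricType R).

Lemma compact_nbhs_inside (S O : set X) : locally_compact [set: X] -> compact S ->
  open O -> S `<=` O -> exists K, [/\ compact K, S `<=` interior K & K `<=` O].
Proof.
move=> lcX cS oO SO.
have /compact_near_coveringP cov := cS.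
pose D := [set K : set X | compact K /\ K `<=` O].
(* These are the tails of the directed family of compact sets inside [O]; the covering property
   along this filter replaces a finite union of local neighbourhoods. *)
pose F := filter_from D (fun K : set X => [set K' : set X | K `<=` K']).
have FF : Filter F.
  apply: filter_from_filter; first by exists set0; split=> //; exact: compact0.
  move=> K1 K2 [cK1 K1O] [cK2 K2O]; exists (K1 `|` K2).
    by split; [exact: compactU|move=> x [/K1O|/K2O]].
  by move=> K /= h; split=> x hx; apply: h; [left|right].
have [x Sx|K [cK KO] KS] := cov _ F (fun K' x => interior K' x) FF; last first.
  by exists K; split=> // x; exact: (KS K).
have [C nC [cC clC]] := lcX x I.
have {}nC : nbhs x C.
  have h : nbhs x [set y | [set: X] y -> C y] := nC.
  by apply: filterS h => y; exact.
have [A nA AO] := uniform_regular (open_nbhs_nbhs (conj oO (SO x Sx))).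
pose B := C `&` closure A.
have nB : nbhs x B by apply: filterI nC _; apply: filterS nA; exact: subset_closure.
exists (interior B, [set K' | B `<=` K']) => /=.
  split; first by apply: open_nbhs_nbhs; split; [exact: open_interior|].
  exists B => //; split; last by move=> y [_ /AO].
  by apply: compact_closedI => //; exact: closed_closure.
by move=> [y K'] /= [By BK']; exact: (interiorS BK').
Qed.

Lemma ball_slack (a y : X) (e : R) : ball a e y -> nbhs a [set z | ball z e y].
Proof.
rewrite ballEmdist /= => ay; have d0 : 0 < e - mdist a y by rewrite subr_gt0.
apply: filterS (nbhsx_ballx a _ d0) => z /=; rewrite !ballEmdist /= => az.
by apply: (le_lt_trans (metric_triangle z a y)); rewrite metric_sym -ltrBrDr.
Qed.

Lemma ball_eq (a y : X) : (forall e : R, 0 < e -> ball a e y) -> a = y.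
Proof.
move=> h; apply/eqP; rewrite -[_ == _]negbK -mdist_gt0; apply/negP => d0.
by have := h _ d0; rewrite ballEmdist /= ltxx.
Qed.

End compact_neighbourhoods.

(** * Pseudo-orbits in [J] starting or ending in the invariant set *)

Section chains.
Context (R : realType) (X : metricType R) (f : X -> X) (S J : set X).
Hypotheses (f_continuous : continuous f) (J_compact : compact J).
Hypotheses (SJ : S `<=` interior J) (JS : inv_map J f = S).

Inductive chain_from (e : R) : X -> Prop :=
| chain_from_base x : S x -> chain_from e x
| chain_from_step x y : chain_from e x -> J y -> ball (f x) e y -> chain_from e y.

Inductive chain_to (e : R) : X -> Prop :=
| chain_to_base x : S x -> chain_to e x
| chain_to_step x y : J x -> ball (f x) e y -> chain_to e y -> chain_to e x.

Definition chain_class (e : R) : set X := chain_from e `&` chain_to e.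

Let SJ' : S `<=` J. Proof. exact: subset_trans SJ (@interior_subset _ _). Qed.
Let X_hausdorff : hausdorff_space X := @metric_hausdorff R X.
Let J_closed : closed J. Proof. exact: compact_closed. Qed.

Let S_image x : S x -> S (f x).
Proof. by rewrite -JS; exact: inv_map_image. Qed.

Let S_preimage x : S x -> exists2 y, S y & f y = x.
Proof. by rewrite -JS; exact: inv_map_preimage. Qed.

Lemma chain_from_J e : chain_from e `<=` J.
Proof. by move=> x [{}x /SJ'|]. Qed.

Lemma chain_to_J e : chain_to e `<=` J.
Proof. by move=> x [{}x /SJ'|]. Qed.

Lemma chain_from_le e e' : e <= e' -> chain_from e `<=` chain_from e'.
Proof.
move=> ee' x; elim=> [{}x Sx|{}x y _ xe' Jy xy]; first exact: chain_from_base.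
exact: (chain_from_step xe' Jy (le_ball ee' xy)).
Qed.

Lemma chain_to_le e e' : e <= e' -> chain_to e `<=` chain_to e'.
Proof.
move=> ee' x; elim=> [{}x Sx|{}x y Jx xy _ ye']; first exact: chain_to_base.
exact: (chain_to_step Jx (le_ball ee' xy) ye').
Qed.

Lemma chain_to_next e x : 0 < e -> chain_to e x ->
  exists2 y, chain_to e y & ball (f x) e y.
Proof.
move=> e0 [{}x Sx|{}x y _ xy ye]; last by exists y.
exists (f x); last exact: ballxx.
by apply: chain_to_base; exact: S_image.
Qed.

Lemma chain_class_next e x : 0 < e -> chain_class e x ->
  exists2 y, chain_class e y & ball (f x) e y.
Proof.
move=> e0 [xD /(chain_to_next e0)[y yB xy]]; exists y => //; split=> //.
exact: (chain_from_step xD (chain_to_J yB) xy).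
Qed.

Lemma chain_class_prev e x : 0 < e -> chain_class e x ->
  exists2 y, chain_class e y & ball (f y) e x.
Proof.
move=> e0 [[{}x Sx|y {}x yD Jx yx] xB].
  have [y Sy <-] := S_preimage Sx; exists y; last exact: ballxx.
  by split; [exact: chain_from_base|exact: chain_to_base].
by exists y => //; split=> //; exact: (chain_to_step (chain_from_J yD) yx xB).
Qed.

(** The permitted error absorbs the passage to the closure: a chain ending near x can jump directly
    to f x. *)
Lemma chain_from_closure e x : 0 < e -> closure (chain_from e) x -> J (f x) ->
  chain_from e (f x).
Proof.
move=> e0 xD Jfx.
have nx : nbhs x [set z | ball (f z) e (f x)].
  exact: (f_continuous (ball_slack (ballxx _ e0))).
by have [z [zD zx]] := xD _ nx; exact: (chain_from_step zD Jfx zx).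
Qed.

(** The error is strictly below e, so the first jump of a chain from x is also available from points
    of [J] near x. *)
Lemma chain_to_nbhs e x : 0 < e -> chain_to e x ->
  nbhs x [set z | J z -> chain_to e z].
Proof.
move=> e0 /(chain_to_next e0)[y yB xy].
have nx : nbhs x [set z | ball (f z) e y].
  exact: (f_continuous (ball_slack xy)).
by apply: filterS nx => z zy Jz; exact: (chain_to_step Jz zy yB).
Qed.

Lemma chain_class_closure_J e : closure (chain_class e) `<=` J.
Proof.
rewrite [X in _ `<=` X](closure_id J).1//; apply: closure_subset => x [xD _].
exact: chain_from_J xD.
Qed.

Let eps (n : nat) : R := n.+1%:R^-1.
Let eps_gt0 n : 0 < eps n. Proof. by rewrite invr_gt0. Qed.
Let eps_anti m n : (m <= n)%N -> eps n <= eps m.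
Proof. by move=> mn; rewrite lef_pV2 ?posrE// ler_nat. Qed.
Let eps_small (r : R) : 0 < r -> exists n, eps n < r.
Proof. by move=> /ltr_add_invr[n]; rewrite add0r; exists n. Qed.

Lemma chain_class_le e e' : e <= e' -> chain_class e `<=` chain_class e'.
Proof.
by move=> ee' x [xD xB]; split; [exact: chain_from_le xD|exact: chain_to_le xB].
Qed.

(** As the error tends to 0, successors and predecessors in the chain classes become exact, so the
    intersection is invariant and hence lies in Inv(J, f) = S. *)
Lemma chain_class_limit : \bigcap_n closure (chain_class (eps n)) `<=` S.
Proof.
set A := \bigcap_n _; rewrite -JS.
have AJ : A `<=` J by move=> x /(_ 0%N I)/chain_class_closure_J.
suff AA : A `<=` inv_map A f by move=> x /AA; exact: inv_map_mono.
apply: inv_map_self => x Ax.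
  move=> n _ B nB; have [r r0 rB] : exists2 r : R, 0 < r & ball (f x) r `<=` B.
    by move: nB; rewrite -nbhs_ballE => -[r r0 rB]; exists r.
  have [m mr] : exists m, eps m < r / 2 by apply: eps_small; rewrite divr_gt0.
  pose k := maxn m n.
  have nx : nbhs x [set z | ball (f x) (r / 2) (f z)].
    by apply: f_continuous; apply: nbhsx_ballx; rewrite divr_gt0.
  have [z [zC xz]] := Ax k I _ nx.
  have [y yC zy] := chain_class_next (eps_gt0 k) zC.
  exists y; split; first by apply: chain_class_le yC; apply: eps_anti; exact: leq_maxr.
  apply: rB; rewrite [r]splitr; apply: (ball_triangle xz); apply: le_ball zy.
  by apply/ltW/(le_lt_trans _ mr)/eps_anti; exact: leq_maxl.
(* Approximate preimages of x: some z in the chain class is within [eps n] of x, and a predecessor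
   of z is mapped within [eps n] of z. *)
pose K n := closure (chain_class (eps n) `&` [set z | ball x (eps n + eps n) (f z)]).
have Kanti m n : (m <= n)%N -> K n `<=` K m.
  move=> mn; apply: closure_subset => z [zC zx]; split.
    by apply: chain_class_le zC; exact: eps_anti.
  by apply: le_ball zx; rewrite lerD// eps_anti.
have Kcompact n : compact (K n).
  apply: (subclosed_compact _ J_compact); first exact: closed_closure.
  apply: subset_trans (chain_class_closure_J (e := eps n)).
  by apply: closure_subset => z [].
have K0 n : K n !=set0.
  have [z [zC xz]] := Ax n I _ (nbhsx_ballx x _ (eps_gt0 n)).
  have [y yC yz] := chain_class_prev (eps_gt0 n) zC.
  exists y; apply: subset_closure; split=> //.
  exact: (ball_triangle xz (ball_sym yz)).
have [y Ky] := compact_nested_nonempty X_hausdorff Kcompact Kanti K0.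
exists y.
  by move=> n _; have := Ky n I; apply: closure_subset => z [].
apply/esym/ball_eq => e e0.
have e4 : 0 < e / 4 by rewrite divr_gt0.
have [n ne] := eps_small e4.
have ny : nbhs y [set z | ball (f z) (e / 2) (f y)].
  by apply: (f_continuous (ball_slack (ballxx (f y) _))); rewrite divr_gt0.
have [z [[_ xz] zy]] := Ky n I _ ny.
rewrite [e]splitr; apply: ball_triangle zy; apply: le_ball xz; lra.
Qed.

Lemma chain_class_small (O : set X) : open O -> S `<=` O ->
  exists2 e : R, 0 < e & closure (chain_class e) `<=` O.
Proof.
move=> oO SO.
have [|m n mn|||n nO] := @compact_nested _ (fun n => closure (chain_class (eps n))) O X_hausdorff.
- move=> n; apply: (subclosed_compact _ J_compact); first exact: closed_closure.
  exact: chain_class_closure_J.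
- by apply: closure_subset; apply: chain_class_le; exact: eps_anti.
- by [].
- exact: subset_trans chain_class_limit SO.
- by exists (eps n).
Qed.

End chains.

(** Explicit conditions on the images of [N] \ [L] and of [L]: they imply that the index map is
    continuous, and they become the exit conditions of the block for the suspension semiflow. *)
Definition filtration_pair (X : topologicalType) (f : X -> X) (S N L : set X) :=
  [/\ compact N, compact L, L `<=` N & S `<=` interior (N `\` L)] /\
  [/\ inv_map N f = S, forall x, (N `\` L) x -> N (f x) &
      forall x, L x -> N (f x) -> L (f x)].

(** [N] \ [L] consists of points with chains both from and to S (up to closure), so for small e it
    stays where f maps into [J]. The set [L] cannot return: a true step of f is a chain step, so f x
    in [B] would put x in [B]. *)
Lemma exists_filtration_pair (R : realType) (X : metricType R) (f : X -> X)
    (S O : set X) : locally_compact [set: X] -> continuous f ->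
  isolated_invariant S f -> open O -> S `<=` O ->
  exists N L, N `<=` O /\ filtration_pair f S N L.
Proof.
move=> lcX cf [cS [M [SM MS]]] oO SO.
have [|x Sx|J [cJ SJ JO]] := @compact_nbhs_inside R X S (O `&` interior M) lcX cS.
- by apply: openI => //; exact: open_interior.
- by split; [exact: SO|exact: SM].
have JM : J `<=` M by move=> x /JO[_ /interior_subset].
have Sf x : S x -> S (f x) by rewrite -MS; exact: inv_map_image.
have Sp x : S x -> exists2 y, S y & f y = x by rewrite -MS; exact: inv_map_preimage.
have Sinv A : S `<=` A -> S `<=` inv_map A f.
  by move=> SA x /(inv_map_self Sf Sp); exact: inv_map_mono.
have SJ' : S `<=` J := subset_trans SJ (@interior_subset _ _).
have JS : inv_map J f = S.
  apply/seteqP; split; last exact: Sinv.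
  by rewrite -[X in _ `<=` X]MS; exact: inv_map_mono.
have J_closed : closed J by apply: compact_closed => //; exact: metric_hausdorff.
(* The error e is chosen so that f maps the closed chain class into [J]; [chain_from_closure] then
   puts the images of points of [N] \ [L] into [N]. *)
have [||e e0 eC] := @chain_class_small R X f S J cf cJ SJ JS
    (interior J `&` f @^-1` interior J).
- apply: openI; first exact: open_interior.
  by apply: open_comp => [x _|]; [exact: cf|exact: open_interior].
- by move=> x Sx; split; [exact: SJ|exact/SJ/Sf].
pose D := @chain_from R X f S J e; pose B := @chain_to R X f S J e.
have DJ : D `<=` J by exact: chain_from_J.
have NJ : closure D `<=` J.
  by rewrite [X in _ `<=` X](closure_id J).1//; exact: closure_subset.
have cN : compact (closure D) by exact: subclosed_compact (@closed_closure _ _) cJ NJ.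
have Bnbhs x : B x -> nbhs x [set z | J z -> B z] by exact: chain_to_nbhs.
(* [B] is open relative to [J], so points of [D] near x are also in [B]; hence the bound on the
   closed chain class applies to x. *)
have NB x : closure D x -> B x -> closure (D `&` B) x.
  move=> Nx Bx A nA; have [z [Dz [Az zB]]] := Nx _ (filterI nA (Bnbhs _ Bx)).
  by exists z; split=> //; split=> //; exact/zB/DJ.
exists (closure D), (closure D `\` B); split; first by move=> x /NJ/JO[].
have NLE : closure D `\` (closure D `\` B) = closure D `&` B.
  apply/seteqP; split=> x [Nx h]; split=> //; last by case.
  by apply: contrapT => nB; apply: h.
rewrite /filtration_pair NLE; split; split=> //.
- apply: (subclosed_compact _ cN); last by move=> x [].
  move=> x cx; split.
    have := @closed_closure _ D; rewrite closure_id => ->.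
    by apply: closure_subset cx => z [].
  by move=> /Bnbhs /cx[z [[Nz nBz] zB]]; exact/nBz/zB/NJ.
- move=> x Sx; have Bx : B x by exact: chain_to_base.
  have [y Sy yx] := Sp _ Sx.
  (* A point of [J] within e of x = f y is reached from y in one jump. *)
  have nD : nbhs x [set z | J z -> D z].
    apply: filterS (nbhsx_ballx x _ e0) => z xz Jz.
    by apply: (chain_from_step (chain_from_base _ _ _ Sy) Jz); rewrite yx.
  have nJ : nbhs x J by exact: SJ.
  apply: filterS (filterI nJ (filterI nD (Bnbhs _ Bx))) => z [Jz [zD zB]].
  by split; [exact/subset_closure/zD|exact: zB].
- apply/seteqP; split; first by rewrite -[X in _ `<=` X]JS; exact: inv_map_mono.
  by apply: Sinv => x Sx; apply: subset_closure; exact: chain_from_base.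
- move=> x [Nx Bx]; have [_ /interior_subset Jfx] := eC _ (NB _ Nx Bx).
  by apply: subset_closure; exact: chain_from_closure.
- move=> x [Nx nBx] Nfx; split=> // Bfx; apply: nBx.
  exact: (chain_to_step (NJ _ Nx) (ballxx _ e0) Bfx).
Qed.

(** Whenever x and f x are in [N], the index map sends the class of x to that of f x, with no case
    distinction, because [L] is positively invariant in [N]. Limits x of points of [N] \ [L] still
    satisfy f x in [N], even if x is in [L], so continuity follows from that of f. *)
Lemma filtration_pair_index (X : topologicalType) (f : X -> X) (S N L : set X) :
  hausdorff_space X -> continuous f -> filtration_pair f S N L ->
  index_pair_map S f N L.
Proof.
move=> hX cf [[cN cL LN SNL] [NS NLN LNL]].
have N_closed : closed N by exact: compact_closed.
split; split=> //.
  apply/seteqP; split.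
    rewrite -[X in _ `<=` X]NS; apply: inv_map_mono.
    by rewrite [X in _ `<=` X](closure_id N).1//; apply: closure_subset => x [].
  have SA : S `<=` closure (N `\` L).
    by apply: subset_trans (@subset_closure _ _); apply: subset_trans SNL (@interior_subset _ _).
  apply: subset_trans (inv_map_mono SA).
  by apply: inv_map_self => x; rewrite -NS; [exact: inv_map_image|exact: inv_map_preimage].
have hP : hausdorff_space (pair_quot N L) by exact: pair_quot_hausdorff.
have mapE x : N x -> (N (f x)) -> pair_map f N L (pair_class N L x) = pair_class N L (f x).
  move=> Nx Nfx; have [[xV fxV]|h] := pselect ((N `\` L) x /\ (N `\` L) (f x)).
    exact: pair_map_in.
  rewrite pair_map_out//; apply/esym/pair_class_base => -[_ nL]; apply: h.
  by split; split=> // Lx; apply: nL; exact: LNL.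
apply: continuous_ultra => p F UF Fp.
have [F0|FN] := in_ultra_setVsetC [set q : pair_quot N L | q = point] UF.
  have p0 : p = point.
    by apply: (hausdorff_lim hP Fp); apply: (cvg_eq_on F0) (cvg_cst _) => q /= ->.
  by rewrite p0 /=; apply: (cvg_eq_on F0) (cvg_cst _) => q /= ->.
have [p1 /= p1N] := @filter_ex _ F _ _ FN; have [x1 _ _] := pair_class_surj p1N.
have /choice[v vP] (q : pair_quot N L) :
    exists x, q <> point -> (N `\` L) x /\ pair_class N L x = q.
  have [q0|/pair_class_surj[x Vx xq]] := pselect (q = point); first by exists x1.
  by exists x.
have FV : F [set q | (N `\` L) (v q) /\ pair_class N L (v q) = q].
  by apply: (@filterS _ F) FN => q /vP.
have FvN : F [set q | N (v q)] by apply: (@filterS _ F) FV => q [[]].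
have [x Nx vx] := compact_ultra_cvg (ultra_fmap v UF) cN FvN.
have fvx : (fun q => f (v q)) @ F --> f x by apply: (cvg_comp2 vx); exact: cf.
have FfN : F [set q | N (f (v q))] by apply: (@filterS _ F) FV => q [/NLN].
have Nfx : N (f x) by exact: (closed_lim (F := (fun q => f (v q)) @ F) N_closed FfN fvx).
have <- : pair_class N L x = p.
  have h : (fun q => pair_class N L (v q)) @ F --> pair_class N L x by exact: pair_class_lim.
  by apply: (hausdorff_lim hP h); apply: (cvg_eq_on FV) Fp => q [_ ->].
rewrite mapE//; apply: (cvg_eq_on (filterI FV FfN)) (pair_class_lim FfN Nfx fvx).
by move=> q [[[Nq Lq] /= qE] Nfq]; rewrite -{2}qE mapE.
Qed.

(** * Index pairs of the suspension semiflow *)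

Section local_properness.
Context (R : realType) (X : metricType R) (f : X -> X).
Hypothesis f_continuous : continuous f.

Section radius.
Variable G : set (X * I01 R).

Let radii (x : X) : set R := [set e : R | 0 < e <= 1 / 2 /\
  forall y s, ball x e y -> 1 - e < val s -> G (y, s)].

(** The size of the largest box below (x, 1) that fits into [G], or 0 if there is none. It serves to
    choose, continuously in x, a height below 1 at which one is still inside [G]. *)
Definition top_radius (x : X) : R := sup (radii x).

Let radii_ubound x : has_ubound (radii x).
Proof. by exists (1 / 2) => e [/andP[]]. Qed.

Lemma top_radius_ge0 x : 0 <= top_radius x.
Proof.
have [[e eE]|/set0P/negP/negPn/eqP E0] := pselect (radii x !=set0).
  apply: le_trans (ub_le_sup (radii_ubound x) eE).
  by case: eE => /andP[/ltW].
by rewrite /top_radius E0 sup0.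
Qed.

Lemma top_radius_le x : top_radius x <= 1 / 2.
Proof.
have [E0|/set0P/negP/negPn/eqP E0] := pselect (radii x !=set0).
  by apply: ge_sup => // e [/andP[]].
by rewrite /top_radius E0 sup0 divr_ge0.
Qed.

(** A box of size e at x contains the box of size e - d at y, where d is the distance of x and y. *)
Lemma top_radius_lipschitz x y : top_radius x <= top_radius y + mdist x y.
Proof.
have y0 := top_radius_ge0 y; have d0 : 0 <= mdist x y by exact: mdist_ge0.
have [E0|/set0P/negP/negPn/eqP E0] := pselect (radii x !=set0); last first.
  by rewrite /(top_radius x) E0 sup0 addr_ge0.
apply: ge_sup => // e [/andP[e0 e1] eG].
have [ed|de] := leP e (mdist x y); first by rewrite (le_trans ed)// lerDr.
rewrite -lerBlDr; apply: (ub_le_sup (radii_ubound y)); split.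
  by apply/andP; split; lra.
move=> z s yz hs; apply: eG; last by lra.
move: yz; rewrite !ballEmdist /= => yz.
by apply: (le_lt_trans (metric_triangle x y z)); lra.
Qed.

Lemma top_radius_continuous : continuous top_radius.
Proof.
move=> x; apply/cvgrPdist_lt => e e0.
apply: filterS (nbhsx_ballx x _ e0) => y; rewrite ballEmdist /= => xy.
apply: le_lt_trans xy; rewrite ler_norml; apply/andP; split.
  by have := top_radius_lipschitz y x; rewrite (metric_sym y x) => yx; lra.
by rewrite lerBlDl; exact: top_radius_lipschitz.
Qed.

Lemma top_radius_gt0 x : open G -> G (x, oneI R) -> 0 < top_radius x.
Proof.
move=> oG Gx; have : nbhs (x, oneI R) G by exact: open_nbhs_nbhs.
move=> [[A B] /= [nA nB] AB].
have [a a0 aA] : exists2 a : R, 0 < a & ball x a `<=` A.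
  by move: nA; rewrite -nbhs_ballE => -[a a0 aA]; exists a.
have [b b0 bB] : exists2 b : R, 0 < b & forall s : I01 R, 1 - b < val s -> B s.
  move: nB; rewrite nbhsE => -[B' [[C oC <-] C1] CB].
  have : nbhs (1 : R) C by apply: open_nbhs_nbhs.
  rewrite -nbhs_ballE => -[b /= b0 bC]; exists b => // s hs; apply: CB; apply: bC.
  have /andP[_ s1] := I01_bounds s.
  by rewrite /ball /= ger0_norm ?subr_ge0// ltrBlDl -ltrBlDr.
pose e := Num.min (Num.min a b) (1 / 2).
have e0 : 0 < e by rewrite !lt_min a0 b0 divr_gt0.
have [ea eb e1] : [/\ e <= a, e <= b & e <= 1 / 2].
  by rewrite /e !ge_min !lexx !orbT.
apply: (lt_le_trans e0); apply: (ub_le_sup (radii_ubound x)); split.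
  by rewrite e0.
move=> y s xy hs; apply: (AB (y, s)); split => /=.
  by apply: aA; exact: le_ball xy.
by apply: bB; apply: le_lt_trans hs; rewrite lerD2l lerN2.
Qed.

Lemma top_radius_in x (s : I01 R) : 1 - top_radius x < val s -> G (x, s).
Proof.
move=> hs; have [E0|/set0P/negP/negPn/eqP E0] := pselect (radii x !=set0); last first.
  have /andP[_ s1] := I01_bounds s; exfalso.
  move: hs; rewrite /top_radius E0 sup0 subr0 => hs.
  by have := lt_le_trans hs s1; rewrite ltxx.
have : 1 - val s < sup (radii x) by rewrite ltrBlDr -ltrBlDl.
move=> /(sup_gt E0)[e [/andP[e0 _] eG] se]; apply: eG; first exact: ballxx.
by rewrite ltrBlDr -ltrBlDl.
Qed.

End radius.

(* The map x |-> [x, 1 - top_radius x / 2] is a closed embedding of the preimage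
   of [A] into [K]. *)
Lemma compact_preimage_near (K : set (mtorus R f)) (A : set X) :
  compact K -> closed A -> (forall x, A x -> interior K (tclass f x (zeroI R))) ->
  compact (f @^-1` A).
Proof.
move=> cK clA AK; pose F := f @^-1` A.
have clF : closed F by apply: closed_comp => // x _; exact: f_continuous.
pose G := [set z : X * I01 R | interior K (tclass f z.1 z.2)].
have oG : open G by apply/open_mtorus; exact: open_interior.
have F1 x : F x -> G (x, oneI R) by rewrite /G /= tclass_glue; exact: AK.
pose rad := top_radius G.
have rad0 x : F x -> 0 < rad x by move=> Fx; exact: top_radius_gt0 (F1 x Fx).
have rad1 x : rad x <= 1 / 2 by exact: top_radius_le.
have radge x : 0 <= rad x by exact: top_radius_ge0.
have rad_cont : continuous rad by exact: top_radius_continuous.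
pose lev x : I01 R := clampI (1 - rad x / 2).
have levE x : val (lev x) = 1 - rad x / 2.
  have h1 := rad1 x; have h2 := radge x.
  by apply: clampI_val; apply/andP; split; lra.
have lev1 x : F x -> val (lev x) < 1.
  by move=> /rad0 h; rewrite levE; lra.
have lev0 x : 0 < val (lev x) by rewrite levE; have := rad1 x; lra.
pose c x := tclass f x (lev x).
have cK' x : F x -> K (c x).
  move=> Fx; apply: interior_subset; apply: (@top_radius_in G x (lev x)).
  by rewrite levE; have := rad0 x Fx; rewrite /rad => h; lra.
(* The inverse image of this set in the product with [0, 1] is the graph of the level function over
   [F]. Its levels are strictly between 0 and 1, so the gluing adds no points to it. *)
have clT : closed (c @` F).
  rewrite -[c @` F]setCK; apply/open_closedC/open_mtorus.
  rewrite (_ : mkset _ = ~` [set z : X * I01 R | F z.1 /\ val z.2 = 1 - rad z.1 / 2]).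
    apply: closed_openC; apply: ultra_closed => U [x s] UU FU Uxs.
    have Ux := lim_fst Uxs; have Us := lim_snd Uxs; split => /=.
      apply: (closed_lim (F := fst @ U) clF _ Ux).
      by apply: (@filterS _ U) FU => z [].
    have lim1 : (fun z : X * I01 R => val z.2) @ U --> val s.
      by apply: (cvg_comp2 Us); exact: val_continuous.
    apply: (hausdorff_lim (@Rhausdorff R) lim1).
    have lim2 : (fun z : X * I01 R => 1 - rad z.1 / 2) @ U --> 1 - rad x / 2.
      apply: cvgB; first exact: cvg_cst.
      by apply: cvgMl; apply: (cvg_comp2 Ux); exact: rad_cont.
    by apply: (cvg_eq_on FU) lim2 => z [].
  apply/seteqP; split=> -[x s] /= h.
    by move=> [Fx sE]; apply: h; exists x => //; congr tclass; apply: I01_eq; rewrite levE.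
  move=> [y Fy /esym/tclass_eq]; rewrite (torus_normal_id f (z := (y, lev y)))//=; last exact: lev1.
  rewrite /torus_normal /=; case: eqP => [_|_] [xy sy].
    by move: (lev0 y); rewrite /= -sy ltxx.
  by apply: h; rewrite xy sy -levE.
apply: ultra_compact => U UU UF.
have UK : (c @ U) K by apply: (@filterS _ U) UF => x; exact: cK'.
have [w _ cw] := compact_ultra_cvg (ultra_fmap c UU) cK UK.
have [x0 Fx0 x0w] : (c @` F) w.
  apply: (closed_lim (F := c @ U) clT _ cw).
  by apply: (@filterS _ U) UF => x Fx; exists x.
exists x0 => //= B; rewrite nbhsE => -[V [oV Vx0] VB].
have [H [oH Hx0 HE]] := torus_nbhd f_continuous oV Vx0 ltr01 (lev1 _ Fx0).
have : (c @ U) H by apply: cw; rewrite -x0w; exact: open_nbhs_nbhs.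
apply: (@filterS _ U) => x /HE[[Vx _]|[l0 _]]; first exact: VB.
by have := lev0 x0; rewrite l0 ltxx.
Qed.

End local_properness.

(** * Blocks over a filtration pair as an index pair of the suspension semiflow *)

Section flow_index_pair.
Context (R : realType) (X : topologicalType) (f : X -> X) (S N L : set X).
Hypotheses (f_continuous : continuous f) (X_hausdorff : hausdorff_space X).
Hypothesis NLP : filtration_pair f S N L.
Hypothesis fN_compact : compact (f @^-1` N).
Local Notation phi := (susp_flow R f).

Let h : R := 1 / 2.

(* Orbits can leave [torus_block N] only at height 1/2.  Taking the preimage
   under f above this height makes it a neighbourhood of the suspension of S
   although the preimage of S need not lie in N. *)
Definition torus_block (A : set X) : set (mtorus R f) :=
  [set w | exists x s, w = tclass f x s /\
    ((A x /\ val s <= h) \/ (A (f x) /\ h <= val s))].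

Lemma torus_blockE A x (s : I01 R) : val s < 1 -> torus_block A (tclass f x s) <->
  (A x /\ val s <= h) \/ (A (f x) /\ h <= val s).
Proof.
move=> s1; split=> [[y [r [/tclass_eq + yr]]]|hx]; last by exists x, s.
rewrite torus_normal_id//; have [r1|r1] := ltP (val r) 1.
  by rewrite torus_normal_id// => -[-> ->].
have {}r1 : val r = 1 by apply/eqP; rewrite eq_le r1 andbT; case/andP: (I01_bounds r).
rewrite torus_normal_one// => -[-> ->]; left; rewrite /= /h; split; last by lra.
by case: yr => -[//]; rewrite r1 /h => _; lra.
Qed.

Lemma torus_block_mono (A B : set X) : A `<=` B -> torus_block A `<=` torus_block B.
Proof.
by move=> AB w [x [s [-> [[/AB Bx hs]|[/AB Bx hs]]]]]; exists x, s; split=> //; [left|right].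
Qed.

Lemma torus_block_compact (A : set X) : compact A -> compact (f @^-1` A) ->
  compact (torus_block A).
Proof.
move=> cA cfA; have -> : torus_block A =
    (fun z : X * I01 R => tclass f z.1 z.2) @`
    ((A `*` [set s : I01 R | val s <= h]) `|` ((f @^-1` A) `*` [set s : I01 R | h <= val s])).
  apply/seteqP; split=> [w [x [s [-> [[Ax hs]|[Ax hs]]]]]|w [[x s] [[Ax hs]|[Ax hs]] <-]].
  - by exists (x, s) => //; left.
  - by exists (x, s) => //; right.
  - by exists x, s; split=> //; left.
  - by exists x, s; split=> //; right.
apply: continuous_compact.
  by apply: continuous_subspaceT; exact: tclass_continuous.
have cI (B : set R) : closed B -> compact [set s : I01 R | B (val s)].
  move=> cB; apply: (subclosed_compact _ (@I01_compact R)) => //.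
  apply: ultra_closed => F p UF FB Fp; apply: (closed_lim (F := val @ F) cB FB).
  exact: (cvg_comp2 Fp (@val_continuous _ _ p)).
apply: compactU; apply: compact_setX => //.
  exact: (cI [set r | r <= h] (@closed_le _ _)).
exact: (cI [set r | h <= r] (@closed_ge _ _)).
Qed.

Lemma torus_block_interior : suspension R f S `<=` interior (torus_block N `\` torus_block L).
Proof.
have [[cN cL LN SNL] [NS NLN LNL]] := NLP.
pose G := interior (N `\` L); have oG : open G by exact: open_interior.
have GN x : G x -> N x /\ ~ L x by move=> /interior_subset[].
(* Three overlapping layers: x decides below height 1/2 and f x above it; the middle layer asks for
   both and covers height 1/2, where the block changes its condition. *)
pose H0 := [set z : X * I01 R | G z.1 /\ val z.2 < h] `|`
  ([set z : X * I01 R | G z.1 /\ G (f z.1) /\ 0 < val z.2 < 1] `|`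
   [set z : X * I01 R | G (f z.1) /\ h < val z.2]).
have o1 (B : set X) : open B -> open [set z : X * I01 R | B z.1].
  by move=> oB; apply: (@open_comp _ _ fst) => // z _; exact: cvg_fst.
have o2 (B : set R) : open B -> open [set z : X * I01 R | B (val z.2)].
  move=> oB; apply: (@open_comp _ _ snd [set r : I01 R | B (val r)]).
    by move=> z _; exact: cvg_snd.
  exact: open_val_lt.
have oGf : open [set z : X * I01 R | G (f z.1)].
  by apply: (o1 (f @^-1` G)); apply: open_comp => // x _; exact: f_continuous.
have lth (a : R) : open [set r : R | r < a] by exact: open_lt.
have gth (a : R) : open [set r : R | a < r] by exact: open_gt.
have oH0 : open H0.
  apply: openU; last apply: openU; apply: openI.
  - exact: o1.
  - exact: (o2 _ (lth h)).
  - exact: o1.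
  - apply: openI => //; have := openI (o2 _ (gth 0)) (o2 _ (lth 1)).
    by rewrite (_ : _ `&` _ = [set z : X * I01 R | 0 < val z.2 < 1])//;
      apply/seteqP; split=> z /= /andP.
  - exact: oGf.
  - exact: (o2 _ (gth h)).
have [x|H oH HE] := @open_torus_saturated R X f H0 oH0.
  split=> [[[_ /=]|[[_ [_ /=]]|[Gx /= _]]]|[[Gx /= _]|[[_ [_ /=]]|[_ /=]]]].
  - by rewrite /h; lra.
  - by rewrite ltxx andbF.
  - by left; split=> //=; rewrite /h; lra.
  - by right; right; split=> //=; rewrite /h; lra.
  - by rewrite ltxx.
  - by rewrite /h; lra.
apply: (@subset_trans _ H); last first.
  move=> w Hw; apply: filterS (open_nbhs_nbhs (conj oH Hw)) => {Hw}w Hw.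
  have [x [s [s1 wE]]] := tclass_surj w; subst w.
  split; first apply/torus_blockE => //.
    case/HE: Hw => [[/GN[Nx _] /= sh]|[[/GN[Nx _] [/GN[Nfx _] _]]|[/GN[Nfx _] /= sh]]].
    + by left; split=> //; exact: ltW.
    + by have [sh|sh] := leP (val s) h; [left|right; split=> //; exact: ltW].
    + by right; split=> //; exact: ltW.
  move=> /(torus_blockE _ _ s1).
  case/HE: Hw => [[/GN[_ nL] /= sh]|[[/GN[_ nL] [/GN[_ nLf] _]]|[/GN[_ nLf] /= sh]]] [[Lx hs]|[Lx hs]] //.
    by have := le_lt_trans hs sh; rewrite ltxx.
  by have := lt_le_trans sh hs; rewrite ltxx.
move=> w [x [s [Sx ->]]]; apply/HE.
have Gx : G x by exact: SNL.
have Gfx : G (f x) by apply: SNL; move: Sx; rewrite -NS; exact: inv_map_image.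
have [sh|sh|sh] := ltgtP (val s) h; [by left|by right; right|right; left].
by split=> //; split=> //=; rewrite [X in 0 < X < 1]sh /h; apply/andP; split; lra.
Qed.

(** Rising past height 1/2 over a point x of [L] within the block of [N] forces f x into [N], hence
    into [L]. So each completed turn starts the next one over a point of [L]. *)
Lemma torus_block_exit_invariant w t : torus_block L w -> 0 < t ->
  orbit_in phi w t (torus_block N) -> orbit_in phi w t (torus_block L).
Proof.
have [[cN cL LN SNL] [NS NLN LNL]] := NLP.
have [x [s [s1 ->]]] := tclass_surj w; have /andP[s0 _] := I01_bounds s.
move=> /(torus_blockE _ _ s1) Lw t0 wN.
have half_in m (q : I01 R) : val q < 1 -> val s <= m%:R + val q <= val s + t ->
    torus_block N (tclass f (iter m f x) q).
  move=> q1 /andP[q2 q3]; have := wN (m%:R + val q - val s).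
  rewrite subr_ge0 q2 lerBlDl q3 => /(_ isT).
  rewrite susp_flow_orbit ?subr_ge0// subrKC addrC -torus_orbit_shift; last by case/andP: (I01_bounds q).
  by rewrite torus_orbit_frac.
have cross m (q : I01 R) : L (iter m f x) -> h < val q < 1 ->
    val s <= m%:R + val q <= val s + t -> L (iter m.+1 f x).
  move=> Lx /andP[hq q1] qt; have /(torus_blockE _ _ q1) := half_in m q q1 qt.
  case=> -[Nx hq']; last exact: LNL.
  by have := le_lt_trans hq' hq; rewrite ltxx.
(* Any height strictly between 1/2 and 1 would serve to witness the crossing. *)
pose q := @clampI R (3 / 4).
have qE : val q = 3 / 4 by rewrite clampI_val//; apply/andP; split; lra.
have qh : h < val q < 1 by rewrite qE /h; apply/andP; split; lra.
have reach m : (m.+1%:R : R) <= val s + t -> L (iter m.+1 f x).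
  elim: m => [|m IH] mt.
    case: Lw => [[Lx sh]|[Lx _]//]; apply: (cross 0%N q) => //.
    by rewrite qE; move: sh mt; rewrite /h => sh mt; apply/andP; split; lra.
  apply: (cross m.+1 q) => //; first by apply: IH; apply: le_trans mt; rewrite ler_nat.
  rewrite qE; move: mt; rewrite -natr1 => mt.
  have : (1 : R) <= m.+1%:R by rewrite ler1n.
  by move=> m1; apply/andP; split; lra.
move=> r /andP[r0 rt]; rewrite susp_flow_orbit//.
have [m [r' [-> mr r'1]]] := torus_orbit_tclass f x (addr_ge0 s0 r0).
have mrt : val s <= m%:R + val r' <= val s + t by rewrite -mr lerDl r0 lerD2l.
apply/torus_blockE => //.
have main : L (iter m f x) -> (L (iter m f x) /\ val r' <= h) \/ (L (f (iter m f x)) /\ h <= val r').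
  move=> Lx; have [r'h|hr'] := leP (val r') h; first by left.
  right; split; last exact: ltW.
  by apply: (cross m r') => //; rewrite hr'.
case: m mr mrt main => [|m] mr mrt main.
  case: Lw => [[Lx sh]|[Lx sh]]; first exact: main.
  by right; split=> //; move: mrt => /andP[]; rewrite add0r => + _; exact: le_trans.
apply: main; apply: reach; case/andP: mrt => _; apply: le_trans; rewrite lerDl.
by case/andP: (I01_bounds r').
Qed.

(** The block can be left only at height 1/2, over some y in [N] with f y outside [N]. Then y is in
    [L], so [y, 1/2] is an exit point. Without exit points, induction over the turns keeps the orbit
    in the block. *)
Lemma torus_block_exit w t : torus_block N w -> 0 < t -> ~ torus_block N (phi w t) ->
  exists t', [/\ 0 <= t' <= t, torus_block L (phi w t') & orbit_in phi w t' (torus_block N)].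
Proof.
have [[cN cL LN SNL] [NS NLN LNL]] := NLP.
have [x [s [s1 ->]]] := tclass_surj w; have /andP[s0 _] := I01_bounds s.
move=> /(torus_blockE _ _ s1) Nw t0 Nwt; apply: contrapT => no_exit; apply: Nwt.
have h0 : 0 <= h by rewrite /h; lra.
have half_bounds : 0 <= h <= 1 by rewrite /h; apply/andP; split; lra.
pose q := mkI half_bounds.
have q1 : val q < 1 by rewrite /= /h; lra.
(* The second conjunct puts the start of the following turn in [N], which is what the induction
   passes on. *)
pose P m := (forall r : I01 R, val r < 1 -> val s <= m%:R + val r <= val s + t ->
    torus_block N (tclass f (iter m f x) r)) /\
  ((m.+1%:R : R) <= val s + t -> N (iter m.+1 f x)).
suff Pall m : P m.
  rewrite susp_flow_orbit ?(ltW t0)//.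
  have [m [r [-> mr r1]]] := torus_orbit_tclass f x (addr_ge0 s0 (ltW t0)).
  have [Pm _] := Pall m; apply: Pm => //.
  by rewrite -mr lexx lerDl ltW.
have [n] := ubnP m; elim: n m => // n IH m; rewrite ltnS => mn.
have from_bottom : N (iter m f x) -> val s <= m%:R + h -> P m.
  move=> Nx sm.
  have cross : m%:R + h <= val s + t -> N (iter m.+1 f x).
    move=> mt; apply: NLN; split=> // Lx; apply: no_exit.
    exists (m%:R + h - val s); split.
    - by rewrite subr_ge0 sm lerBlDl.
    - rewrite susp_flow_orbit ?subr_ge0// subrKC addrC.
      rewrite -torus_orbit_shift//.
      rewrite -[h]/(val q) torus_orbit_frac; apply/torus_blockE => //; left.
      by split=> //=.
    - move=> r /andP[r0 rm]; rewrite susp_flow_orbit//.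
      have [k [r' [-> kr r'1]]] := torus_orbit_tclass f x (addr_ge0 s0 r0).
      have /andP[r'0 _] := I01_bounds r'.
      have krm : k%:R + val r' <= m%:R + h by rewrite -kr -lerBrDl.
      have [km|mk] := ltnP k m.
        have [Pk _] := IH k (leq_trans km mn); apply: Pk => //.
        by rewrite -kr lerDl r0 kr (le_trans krm).
      have mkR : (m%:R : R) <= k%:R by rewrite ler_nat.
      have mE : k = m.
        apply/eqP; rewrite eqn_leq mk andbT -ltnS -(ltr_nat R) -natr1.
        by move: krm; rewrite /h => krm; lra.
      subst k; apply/torus_blockE => //; left; split=> //.
      by move: krm; rewrite lerD2l.
  split=> [r r1 /andP[_ rt]|mt]; last first.
    by apply: cross; apply: le_trans mt; rewrite -natr1 lerD2l /h; lra.
  apply/torus_blockE => //; have [rh|hr] := leP (val r) h; first by left.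
  by right; split; [apply: cross; apply: le_trans rt; rewrite lerD2l ltW|exact: ltW].
case: m mn from_bottom => [|m] mn from_bottom.
  (* A start in the upper half gives only [N (f x)], but the rest of that turn stays at heights at
     least 1/2, where this is the condition. *)
  case: Nw => [[Nx sh]|[Nx sh]]; first by apply: from_bottom; rewrite ?add0r.
  split=> [r r1 /andP[sr _]|//]; apply/torus_blockE => //; right; split=> //.
  by move: sr; rewrite add0r; exact: le_trans.
have [mt|tm] := leP (m.+1%:R : R) (val s + t).
  apply: from_bottom; first by have [_] := IH m mn; exact.
  apply: (le_trans (ltW s1)); apply: (@le_trans _ _ (m.+1%:R)); first by rewrite ler1n.
  by rewrite lerDl.
split=> [r r1 /andP[_ rt]|mt].
  have /andP[r0 _] := I01_bounds r.
  have : (m.+1%:R : R) <= m.+1%:R + val r by rewrite lerDl.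
  by move=> /le_trans/(_ rt); rewrite leNgt tm.
have : (m.+1%:R : R) <= m.+2%:R by rewrite ler_nat.
by move=> /le_trans/(_ mt); rewrite leNgt tm.
Qed.

Lemma torus_block_index_pair :
  index_pair_flow (suspension R f S) phi (torus_block N) (torus_block L).
Proof.
have [[cN cL LN SNL] [NS NLN LNL]] := NLP.
have L_closed : closed L by exact: compact_closed.
have W_hausdorff := mtorus_hausdorff (R := R) f_continuous X_hausdorff.
have cN' : compact (torus_block N) by exact: torus_block_compact.
have cfL : compact (f @^-1` L).
  apply: (subclosed_compact _ fN_compact) => [|x /LN//].
  by apply: closed_comp => // x _; exact: f_continuous.
have Sint := torus_block_interior.
split; split=> //.
- exact: torus_block_compact.
- exact: torus_block_mono.
- apply/seteqP; split; last first.
    have Sinv : suspension R f S `<=` inv_flow (suspension R f S) phi.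
      by rewrite -NS; exact: suspension_inv_flow.
    move=> w /Sinv[g [g0 gM gS]]; exists g; split=> // u.
    by apply: subset_closure; apply: interior_subset; exact: Sint.
  (* Below height 1/2, and at 1/4 in particular, the block of [N] consists of the points over
     [N]. *)
  have quarter_bounds : 0 <= (1 / 4 : R) <= 1 by apply/andP; split; lra.
  rewrite -NS; apply: (inv_flow_suspension (q := mkI quarter_bounds)); last by rewrite /=; lra.
  have clN : closure (torus_block N `\` torus_block L) `<=` torus_block N.
    rewrite [X in _ `<=` X](closure_id _).1; last exact: compact_closed.
    by apply: closure_subset => w [].
  move=> x /clN/torus_blockE[|[]//|[_]]; rewrite /= ?/h; lra.
- exact: torus_block_exit_invariant.
- exact: torus_block_exit.
Qed.

End flow_index_pair.

(* The two pointed homotopy types agree for all choices of index pairs.  An index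
   pair for the suspension semiflow contains a compact neighbourhood of the
   suspension of S; if f is not proper near S there may be none (e.g. f = 0 on
   the real line and S = {0}), hence the proviso in the second clause. *)
Theorem theorem7p3 (R : realType) (X : metricType R) (f : X -> X)
    (X_locally_compact : locally_compact [set: X])
    (f_continuous : continuous f)
    (S : set X) (S_isolated : isolated_invariant S f) :
  (exists N L : set X, index_pair_map S f N L) /\
  ((exists K : set (mtorus R f),
      compact K /\ suspension R f S `<=` interior K) ->
    exists N' L' : set (mtorus R f),
      index_pair_flow (suspension R f S) (susp_flow R f) N' L') /\
  (forall N L : set X, index_pair_map S f N L ->
    forall N' L' : set (mtorus R f),
      index_pair_flow (suspension R f S) (susp_flow R f) N' L' ->
      same_phomotopy_type R
        (rmtorus R (pair_map f N L)) (pair_quot N' L')).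
Proof.
have hX : hausdorff_space X by exact: metric_hausdorff.
split; [|split].
- have [N [L [_ NLP]]] := exists_filtration_pair X_locally_compact f_continuous
    S_isolated openT (@subsetT _ S).
  by exists N, L; exact: filtration_pair_index.
- move=> [K [cK SK]].
  (* With [N] inside this open set, [compact_preimage_near] makes f^-1(N) compact. *)
  pose V := [set y | interior K (tclass f y (zeroI R))].
  have oV : open V.
    have cz : continuous (fun y => tclass f y (zeroI R)).
      move=> y; apply: (@tclass_lim R X f _ (nbhs y) _ id (fun=> zeroI R)).
        exact: cvg_id.
      exact: cvg_cst.
    by apply: (open_comp (fun y _ => cz y)); exact: open_interior.
  have SV : S `<=` V by move=> x Sx; apply: SK; exists x, (zeroI R).
  have [N [L [NV NLP]]] := exists_filtration_pair X_locally_compact f_continuous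
    S_isolated oV SV.
  exists (torus_block N), (torus_block L); apply: torus_block_index_pair => //.
  apply: (compact_preimage_near f_continuous cK) => //.
  by case: NLP => -[cN _ _ _] _; exact: compact_closed.
- move=> N L NLP N' L' N'L'P.
  have phiP := susp_semiflow R f_continuous.
  have hW := mtorus_hausdorff (R := R) f_continuous hX.
  exact: (flow_models_phomotopy phiP hW (rmtorus_flow_model R f_continuous hX NLP)
    (pair_quot_flow_model phiP hW N'L'P)).
Qed.
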